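(* For every $r\in(0,1)$ there is a constant $c=c(r)>0$, depending only on $r$, such that the following holds. Let $d>0$, $a>0$, $\epsilon>0$, let $x\in\mathbb{C}$, $t>0$ be such that $\mathbb{D}(x,t/r)\subset\mathbb{D}_r$, and let $\omega\subset\mathbb{D}(x,t)$ be a compact set of class $\mathcal{A}(d,a)$ with $\mathcal{H}^d(\omega)\ge\epsilon$. Then for every subharmonic function $f$ on $\mathbb{D}_1$ and all real $M_1,M_2$ with $$\sup_{\mathbb{D}_1}f\le M_1\quad\text{and}\quad \sup_{\mathbb{D}_r}f\ge M_2,$$ one has $$\sup_{\mathbb{D}(x,t)}f\le\sup_{\omega}f+(M_1-M_2)\,c\,\log\frac{4e\,t\,a^{1/d}}{r\,(d\epsilon)^{1/d}}.$$
   Context: $\mathbb{D}_s=\{z\in\mathbb{C}:|z|<s\}$ and $\mathbb{D}(x,t)=\{z\in\mathbb{C}:|z-x|<t\}$. $\mathcal{H}^d$ is the $d$-dimensional Hausdorff measure. A compact set $K\subset\mathbb{C}$ belongs to $\mathcal{A}(d,a)$ if $\mathcal{H}^d(K\cap\mathbb{D}(y,s))\le a s^d$ for all $y\in K$ and $0<s\le\operatorname{diam}(K)$. *)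

(* Defs.v *)
From mathcomp Require Import all_boot all_order all_algebra.
From mathcomp Require Export complex.
From mathcomp Require Import all_classical all_reals all_analysis.

Set Implicit Arguments.
Unset Strict Implicit.
Unset Printing Implicit Defensive.

Import Order.TTheory GRing.Theory Num.Theory.
Import numFieldNormedType.Exports.

Local Open Scope classical_set_scope.
Local Open Scope ring_scope.
Local Open Scope complex_scope.

Section defs.
Context {R : realType}.
Implicit Types (A K U : set R[i]) (f : R[i] -> \bar R).

(* [Normc.normc] is the modulus as an element of [R]
   ([`|z|] is the same number, as an element of [R[i]]). *)
Definition disc (z : R[i]) (s : R) : set R[i] :=
  [set w | Normc.normc (w - z) < s].

Definition cdisc (z : R[i]) (s : R) : set R[i] :=
  [set w | Normc.normc (w - z) <= s].

(* Adding [0] only serves to get [diam set0 = 0] instead of [-oo]. *)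
Definition diam A : \bar R :=
  ereal_sup (0%E |` [set (Normc.normc (p.1 - p.2))%:E | p in A `*` A]).

Local Open Scope ereal_scope.

Definition hausdorff_content (d delta : R) A : \bar R :=
  ereal_inf [set \sum_(0 <= k <oo) diam (U k) `^ d | U in
    [set U : (set R[i])^nat |
      A `<=` \bigcup_k U k /\ forall k, diam (U k) <= delta%:E]].

(* Only used for [0 < d], so that empty or one-point sets contribute [0].
   No normalising constant is included: rescaling the measure rescales the
   constants [a] in [class_A] and lower bounds by the same factor. *)
Definition hausdorff_measure (d : R) A : \bar R :=
  ereal_sup [set hausdorff_content d delta A | delta in [set e | (0 < e)%R]].

(* [R[i]^o] carries the topology of the modulus. *)
Definition class_A (d a : R) K : Prop :=
  compact (K : set R[i]^o) /\
  forall (y : R[i]) (s : R), K y -> (0 < s)%R -> s%:E <= diam K ->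
    hausdorff_measure d (K `&` disc y s) <= (a * s `^ d)%:E.

Definition circle_point (z : R[i]) (rho theta : R) : R[i] :=
  (z + rho%:C * (cos theta +i* sin theta))%R.

(* A circular mean is well defined in [-oo, +oo[ for an upper semicontinuous
   [f < +oo] (its positive part is bounded on the circle), and it may be [-oo];
   the function identically [-oo] is not excluded.  [f] is only constrained
   on [U], which is meant to be open. *)
Definition subharmonic_on U f : Prop :=
  [/\ forall z, U z -> f z < +oo,
      forall z (b : R), U z -> f z < b%:E ->
        \forall w \near (z : R[i]^o), f w < b%:E &
      forall z (rho : R), (0 < rho)%R -> cdisc z rho `<=` U ->
        f z <= ((2 * pi)^-1)%:E *
          \int[lebesgue_measure]_(theta in `[0%R, (2 * pi)%R])
             f (circle_point z rho theta)].

End defs.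

(* Main.v *)
(* Normalise f <= M1 on the unit disc and compare it with potentials
   g = sum_i m_i log |B_{p_i}|, where B_p is the Blaschke factor at p: if f <= M1 + g
   on the boundary of a union of small discs about the poles p_i, then f <= M1 + g
   off these discs, by the maximum principle.
   With a single pole x this gives a doubling inequality: passing from D(x,t) to
   D(x,t/r) increases sup f by at most c(r) (M1 - M2).  Next rescale D(x,t/r) to the
   unit disc.  As f is upper semicontinuous, f <= sup_omega f + delta on discs of some
   radius eta about the points of omega, and a Frostman-type argument at scale eta gives
   finitely many poles in omega with masses of sum 1 whose potential is bounded by a
   multiple of the logarithm L in the statement.  Since |B_p(z)| stays below a constant
   less than 1 for |p|, |z| < r, the comparison shows that sup f over D(x,t) would drop
   below itself unless sup_{D(x,t)} f - sup_omega f is at most a constant times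
   (M1 - M2) L. *)
Require Import Defs.
From mathcomp Require Import all_boot all_order all_algebra.
From mathcomp Require Import all_classical all_reals all_analysis.
From mathcomp Require Import measurable_realfun ring lra.

Set Implicit Arguments.
Unset Strict Implicit.
Unset Printing Implicit Defensive.

Import Order.TTheory GRing.Theory Num.Theory.
Import numFieldNormedType.Exports.

Local Open Scope classical_set_scope.
Local Open Scope ring_scope.

Local Notation normc := Normc.normc.

(** * A discrete Frostman measure *)

(** With finitely many poles no limit measure has to be formed. The number of scales depends on
    [eta], but the bound for the potential does not: the mass of the layer at scale j is at most the
    smaller of the total mass [M] and [2 ^- j], and summing this over all scales costs only
    [ln M^-1]. The lower bound for [M] is where [a], [eps] and the class of [omega] enter.

    The maximum principle is drawn from the circular mean inequality alone: the potential is made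
    strictly superharmonic by a small quadratic penalty, and a second order expansion at an interior
    maximum is averaged over a small circle.

    The conclusion is a self-improvement. Let S be the supremum over D(x,t), C the doubling bound,
    b' slightly above the supremum over [omega], and choose the multiple sg of the potential by sg *
    L = S + C - b'. On D(x,t) the comparison gives either f <= b' or f <= S + C - sg * gap. If b' <
    S, the supremum S cancels, leaving sg * gap <= C, which bounds S - b' by a multiple of C * L.
    Rescaling divides distances by t / r, so that ln (4t / |z - p|) only gains [ln r^-1]. *)

Section Greedy.
Context {R : realFieldType} {I K : finType} (S : K -> {set I}) (b : K -> R).

(** Indices are treated one at a time: the weight of [i] is raised by the least slack among the
    constraints containing [i], which saturates one of them and violates none. A constraint
    saturated earlier stays so, since weights only grow and its bound still holds. *)
Lemma greedy_tight_weights :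
  (forall k, 0 <= b k) -> (forall i, exists k, i \in S k) ->
  exists m : I -> R, [/\ forall i, 0 <= m i,
    forall k, \sum_(i in S k) m i <= b k &
    forall i, exists2 k, i \in S k & \sum_(j in S k) m j = b k].
Proof.
move=> b0 cov.
suff [m [m0 mle mt]] : exists m : I -> R, [/\ forall i, 0 <= m i,
    forall k, \sum_(i in S k) m i <= b k &
    forall i, i \in enum I -> exists2 k, i \in S k & \sum_(j in S k) m j = b k].
  by exists m; split=> // i; apply: mt; rewrite mem_enum.
elim: (enum I) => [|i s [m [m0 mle mt]]].
  by exists (fun=> 0); split=> // k; rewrite big1.
have [k0 ik0] := cov i.
pose g k := b k - \sum_(j in S k) m j.
pose k1 := [arg min_(k < k0 | i \in S k) g k]%O.
have [ik1 kmin] : i \in S k1 /\ forall k, i \in S k -> g k1 <= g k.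
  by rewrite /k1; case: arg_minP => // k ik kmin; split.
pose m' j := m j + (if j == i then g k1 else 0).
have g0 : 0 <= g k1 by rewrite subr_ge0.
have sumE k : \sum_(j in S k) m' j =
    \sum_(j in S k) m j + (if i \in S k then g k1 else 0).
  rewrite big_split /=; congr (_ + _); rewrite -big_mkcondr /=.
  case: ifPn => ik; last by rewrite big1 // => j /andP[jk /eqP ji]; rewrite -ji jk in ik.
  by rewrite (big_pred1 i) // => j /=; case: eqP => [->|]; rewrite ?andbT ?andbF.
have m'le k : \sum_(j in S k) m' j <= b k.
  by rewrite sumE; case: ifPn => ik; rewrite ?addr0 // -lerBrDl; exact: kmin.
exists m'; split=> //.
- by move=> j; rewrite /m' addr_ge0 //; case: ifP.
- move=> j; rewrite inE => /orP[/eqP ->|js].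
    by exists k1 => //; rewrite sumE ik1 addrC subrK.
  have [k jk kt] := mt _ js; exists k => //; apply/eqP.
  by rewrite eq_le m'le -kt ler_sum // => l _; rewrite lerDl; case: ifP.
Qed.
End Greedy.

Section Vitali.
Variables (T : eqType) (level : T -> nat) (disj : rel T).

(** Scanning by increasing level (decreasing radius in the application), an element is kept only if
    it is disjoint from all those kept before; otherwise it meets one whose level is at most its
    own. The alternative [y == x] serves a kept element, which [disj] may relate to itself. *)
Lemma vitali_selection (s : seq T) : exists D : seq T,
  [/\ {subset D <= s}, pairwise disj D &
      forall x, x \in s -> exists2 y, y \in D &
        (level y <= level x)%N && ((y == x) || ~~ disj y x)].
Proof.
set leT := fun x y => (level x <= level y)%N.
have tot : total leT by move=> x y; exact: leq_total.
suff [D [Ds pD DP]] : exists D : seq T,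
  [/\ {subset D <= sort leT s}, pairwise disj D &
      forall x, x \in sort leT s -> exists2 y, y \in D &
        (level y <= level x)%N && ((y == x) || ~~ disj y x)].
  exists D; split=> // [x /Ds|x xs]; first by rewrite mem_sort.
  by apply: DP; rewrite mem_sort.
have : sorted leT (sort leT s) by exact: sort_sorted.
elim/last_ind: (sort leT s) => [|t x IH] srt; first by exists [::].
have tr : transitive leT by move=> a b c; exact: leq_trans.
have {}/IH [D [Dt pD DP]] : sorted leT t.
  by move: srt; rewrite -cats1 => /(subseq_sorted tr (prefix_subseq _ _)).
have tx y : y \in t -> (level y <= level x)%N.
  move: srt; rewrite sorted_pairwise // pairwise_rcons => /andP[/allP tx _].
  exact: tx.
have [/hasP[y yD ndxy]|/hasPn nD] := boolP (has (fun y => ~~ disj y x) D).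
  exists D; split=> //.
    by move=> z /Dt; rewrite mem_rcons inE => ->; rewrite orbT.
  move=> z; rewrite mem_rcons inE => /orP[/eqP ->|/DP //].
  by exists y => //; rewrite ndxy orbT andbT tx // Dt.
exists (rcons D x); split.
- move=> z; rewrite !mem_rcons !inE => /orP[->//|/Dt ->]; exact: orbT.
- by rewrite pairwise_rcons pD andbT; apply/allP => z /nD /negPn.
- move=> z; rewrite mem_rcons inE => /orP[/eqP ->|/DP[y yD yz]].
    by exists x; rewrite ?mem_rcons ?inE eqxx // leqnn.
  by exists y => //; rewrite mem_rcons inE yD orbT.
Qed.
End Vitali.

(** * Finite subadditivity of the Hausdorff measure *)

Section Hausdorff.
Local Open Scope complex_scope.
Context {R : realType}.
Implicit Types (A B : set R[i]) (U V : (set R[i])^nat) (d : R).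
Local Open Scope ereal_scope.

Lemma diam_ge0 A : 0 <= diam A.
Proof. by apply: ereal_sup_ubound; left. Qed.

Lemma diam_le A (b : R) : (0 <= b)%R ->
  (forall p q, A p -> A q -> (normc (p - q) <= b)%R) -> diam A <= b%:E.
Proof.
move=> b0 Ab; apply: ge_ereal_sup => _ [->|[[p q] /= [Ap Aq]] <-] //.
by rewrite lee_fin Ab.
Qed.

Lemma diam_ub A p q : A p -> A q -> (normc (p - q))%:E <= diam A.
Proof. by move=> Ap Aq; apply: ereal_sup_ubound; right; exists (p, q). Qed.

(** Two countable covers are merged by alternating their terms; a partial sum of even length splits
    into one partial sum of each series. *)
Lemma nneseries_interleave (u v : (\bar R)^nat) :
  (forall k, 0 <= u k) -> (forall k, 0 <= v k) ->
  \sum_(0 <= k <oo) (if odd k then v k./2 else u k./2) <=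
  \sum_(0 <= k <oo) u k + \sum_(0 <= k <oo) v k.
Proof.
move=> u0 v0; set w := fun k => if odd k then v k./2 else u k./2.
have w0 k : 0 <= w k by rewrite /w; case: ifP.
have wE n : \sum_(0 <= k < n.*2) w k =
    \sum_(0 <= k < n) u k + \sum_(0 <= k < n) v k.
  elim: n => [|n IH]; first by rewrite !big_geq // adde0.
  rewrite doubleS !big_nat_recr //= IH /w /= odd_double /= uphalf_double half_double.
  by rewrite -addeA addeACA.
apply: lime_le; first by apply: is_cvg_nneseries => n _ _; exact: w0.
near=> n; apply: (@le_trans _ _ (\sum_(0 <= k < n.*2) w k)).
  apply: lee_sum_nneg_natr => [k _ _|]; first exact: w0.
  by rewrite -addnn leq_addr.
by rewrite wE; apply: leeD; apply: nneseries_lim_ge.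
Unshelve. all: by end_near. Qed.

Lemma hausdorff_content_ge0 d (delta : R) A : 0 <= hausdorff_content d delta A.
Proof.
apply: le_ereal_inf_tmp => _ [U _ <-]; apply: nneseries_ge0 => n _ _.
exact: poweR_ge0.
Qed.

Lemma hausdorff_contentU d (delta : R) A B :
  hausdorff_content d delta (A `|` B) <=
  hausdorff_content d delta A + hausdorff_content d delta B.
Proof.
have [cA0 cB0] := (hausdorff_content_ge0 d delta A, hausdorff_content_ge0 d delta B).
have [Ay|Afin] := eqVneq (hausdorff_content d delta A) +oo.
  by rewrite Ay addye ?leey // -ltNye (lt_le_trans _ cB0).
have [By|Bfin] := eqVneq (hausdorff_content d delta B) +oo.
  by rewrite By addey ?leey // -ltNye (lt_le_trans _ cA0).
have {}Afin : hausdorff_content d delta A \is a fin_num.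
  by rewrite ge0_fin_numE // ltey.
have {}Bfin : hausdorff_content d delta B \is a fin_num.
  by rewrite ge0_fin_numE // ltey.
apply/lee_addgt0Pr => e e0.
have e2 : (0 < e / 2)%R by rewrite divr_gt0.
have [_ [U [AU Ud] <-] Ue] := lb_ereal_inf_adherent e2 Afin.
have [_ [V [BV Vd] <-] Ve] := lb_ereal_inf_adherent e2 Bfin.
apply: (@le_trans _ _ (\sum_(0 <= k <oo) diam (U k) `^ d +
  \sum_(0 <= k <oo) diam (V k) `^ d)); last first.
  rewrite [in leRHS](splitr e) EFinD addeACA; apply: leeD; exact: ltW.
apply: (le_trans _ (nneseries_interleave (fun k => poweR_ge0 (diam (U k)) d)
  (fun k => poweR_ge0 (diam (V k)) d))).
apply: ereal_inf_lbound.
exists (fun k => if odd k then V k./2 else U k./2); last first.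
  by congr (limn _); apply/funext => n; apply: eq_bigr => k _; case: ifP.
split; last by move=> k; case: ifP.
move=> z [/AU[k _ Uk]|/BV[k _ Vk]].
  by exists k.*2 => //; rewrite odd_double half_double.
by exists k.*2.+1 => //=; rewrite odd_double /= uphalf_double.
Qed.

Lemma hausdorff_measure_ge0 d A : 0 <= hausdorff_measure d A.
Proof.
apply: (le_trans (hausdorff_content_ge0 d 1 A)).
by apply: ereal_sup_ubound; exists 1%R => //=.
Qed.

Lemma hausdorff_measureU d A B :
  hausdorff_measure d (A `|` B) <= hausdorff_measure d A + hausdorff_measure d B.
Proof.
apply: ge_ereal_sup => _ [e e0 <-]; apply: (le_trans (hausdorff_contentU _ _ _ _)).
by apply: leeD; apply: ereal_sup_ubound; exists e.
Qed.

Lemma le_hausdorff_measure d A B :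
  A `<=` B -> hausdorff_measure d A <= hausdorff_measure d B.
Proof.
move=> AB; apply: ge_ereal_sup => _ [e e0 <-].
apply: (@le_trans _ _ (hausdorff_content d e B)); last first.
  by apply: ereal_sup_ubound; exists e.
apply: le_ereal_inf_tmp => _ [U [BU Ud] <-]; apply: ereal_inf_lbound.
by exists U => //; split=> //; exact: subset_trans BU.
Qed.

(** [A] repeated forever is a cover of cost zero, because 0 to the positive power [d] is 0. *)
Lemma hausdorff_measure_small d A : (0 < d)%R ->
  diam A = 0 -> hausdorff_measure d A = 0.
Proof.
move=> d0 A0; apply/eqP; rewrite eq_le hausdorff_measure_ge0 andbT.
apply: ge_ereal_sup => _ [e e0 <-]; apply: ereal_inf_lbound.
have D0 (U : set R[i]) : U `<=` A -> diam U = 0.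
  move=> UA; apply/eqP; rewrite eq_le diam_ge0 andbT -A0.
  apply: ge_ereal_sup => _ [->|[[p q] /= [Up Uq]] <-]; first exact: diam_ge0.
  by apply: diam_ub; apply: UA.
exists (fun k => A); last first.
  by apply: eseries0 => k _ _; rewrite A0 poweR0r // gt_eqF.
by split; [move=> z Az; exists 0%N | move=> k; rewrite A0 lee_fin ltW].
Qed.

Lemma hausdorff_measure_bigcup d (I : eqType) (s : seq I) (P : I -> set R[i]) A :
  A `<=` [set z | exists2 i, i \in s & P i z] -> (0 < d)%R ->
  hausdorff_measure d A <= \sum_(i <- s) hausdorff_measure d (A `&` P i).
Proof.
move=> AP d0.
(* In the induction the covered set [B] shrinks while the measured pieces remain those of [A]. *)
suff {AP} H B : B `<=` A -> B `<=` [set z | exists2 i, i \in s & P i z] ->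
    hausdorff_measure d B <= \sum_(i <- s) hausdorff_measure d (A `&` P i).
  exact: H.
elim: s B => [|i s IH] B BA /= BP.
  rewrite big_nil hausdorff_measure_small //; apply/eqP.
  rewrite eq_le diam_ge0 andbT; by apply: diam_le => // p q /BP[] i.
rewrite big_cons.
have -> : B = (B `&` P i) `|` (B `&` ~` P i) by rewrite -setIUr setUv setIT.
apply: (le_trans (hausdorff_measureU _ _ _)); apply: leeD.
  by apply: le_hausdorff_measure; apply: setSI.
apply: IH => [z [/BA]//|z [/BP[j]]].
by rewrite inE => /predU1P[->//|js] Pj _; exists j.
Qed.

End Hausdorff.
Section Modulus.
Local Open Scope complex_scope.
Context {R : realType}.
Implicit Types (p q z : R[i]).

Lemma normcE (a b : R) : normc (a +i* b) = Num.sqrt (a ^+ 2 + b ^+ 2).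
Proof. by []. Qed.

Lemma normc_ge0 z : 0 <= normc z.
Proof. by case: z => a b; exact: sqrtr_ge0. Qed.

Lemma sqr_normc (a b : R) : normc (a +i* b) ^+ 2 = a ^+ 2 + b ^+ 2.
Proof. by rewrite sqr_sqrtr // addr_ge0 // sqr_ge0. Qed.

Lemma normc_distC p q : normc (p - q) = normc (q - p).
Proof. by rewrite -[LHS](normcN (p - q)) opprB. Qed.

Lemma normc_triangle q p z : normc (p - z) <= normc (p - q) + normc (q - z).
Proof.
have -> : p - z = (p - q) + (q - z) by rewrite addrA subrK.
exact: le_normcD.
Qed.

(* The Gram determinant of three vectors of the plane vanishes, whereas it is
   [s ^+ 6 / 2] for the edge vectors of a regular simplex. *)
Lemma no_four_equidistant_points (s : R) p0 p1 p2 p3 : 0 < s ->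
  normc (p1 - p0) = s -> normc (p2 - p0) = s -> normc (p3 - p0) = s ->
  normc (p2 - p1) = s -> normc (p3 - p1) = s -> normc (p3 - p2) = s -> False.
Proof.
case: p0 p1 p2 p3 => [a0 b0] [a1 b1] [a2 b2] [a3 b3] s0 E1 E2 E3 E4 E5 E6.
have sq (a b a' b' : R) : normc ((a +i* b) - (a' +i* b')) = s ->
    (a - a') ^+ 2 + (b - b') ^+ 2 = s ^+ 2 by move=> <-; rewrite -sqr_normc.
move: E1 E2 E3 E4 E5 E6 => /sq E1 /sq E2 /sq E3 /sq E4 /sq E5 /sq E6.
set u1 := a1 - a0; set u2 := b1 - b0; set v1 := a2 - a0; set v2 := b2 - b0.
set w1 := a3 - a0; set w2 := b3 - b0.
have uu : u1 ^+ 2 + u2 ^+ 2 = s ^+ 2 by [].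
have vv : v1 ^+ 2 + v2 ^+ 2 = s ^+ 2 by [].
have ww : w1 ^+ 2 + w2 ^+ 2 = s ^+ 2 by [].
have uv : u1 * v1 + u2 * v2 = s ^+ 2 / 2 by rewrite /u1 /u2 /v1 /v2; lra.
have uw : u1 * w1 + u2 * w2 = s ^+ 2 / 2 by rewrite /u1 /u2 /w1 /w2; lra.
have vw : v1 * w1 + v2 * w2 = s ^+ 2 / 2 by rewrite /v1 /v2 /w1 /w2; lra.
have : (u1 ^+ 2 + u2 ^+ 2) * ((v1 ^+ 2 + v2 ^+ 2) * (w1 ^+ 2 + w2 ^+ 2)
     - (v1 * w1 + v2 * w2) ^+ 2)
   - (u1 * v1 + u2 * v2) * ((u1 * v1 + u2 * v2) * (w1 ^+ 2 + w2 ^+ 2)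
     - (v1 * w1 + v2 * w2) * (u1 * w1 + u2 * w2))
   + (u1 * w1 + u2 * w2) * ((u1 * v1 + u2 * v2) * (v1 * w1 + v2 * w2)
     - (v1 ^+ 2 + v2 ^+ 2) * (u1 * w1 + u2 * w2)) = 0 by ring.
rewrite uu vv ww uv uw vw => E.
have : s ^+ 6 = 0.
  have -> : s ^+ 6 = 2 * (s ^+ 2 * (s ^+ 2 * s ^+ 2 - (s ^+ 2 / 2) ^+ 2) -
      s ^+ 2 / 2 * (s ^+ 2 / 2 * s ^+ 2 - s ^+ 2 / 2 * (s ^+ 2 / 2)) +
      s ^+ 2 / 2 * (s ^+ 2 / 2 * (s ^+ 2 / 2) - s ^+ 2 * (s ^+ 2 / 2))) by field.
  by rewrite E mulr0.
by move/eqP; rewrite expf_eq0 /= gt_eqF.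
Qed.

End Modulus.

(** * Measure bounds for sets of class A(d, a) *)

Section ClassA.
Local Open Scope complex_scope.
Context {R : realType}.
Variables (d a : R) (K : set R[i]).
Hypotheses (d0 : 0 < d) (a0 : 0 < a) (KA : class_A d a K).

(* Open discs of radius [diam K] centred in [K] may miss points at distance exactly
   [diam K]; since the plane contains no regular 3-simplex, three of them cover [K]. *)
Lemma class_A_measure_le (s : R) : 0 < s -> diam K = s%:E ->
  (hausdorff_measure d K <= (3 * a * s `^ d)%:E)%E.
Proof.
move=> s0 Ks.
have dist p q : K p -> K q -> ~ disc p s q -> normc (q - p) = s.
  move=> Kp Kq /negP; rewrite -leNgt => sd; apply/eqP.
  by rewrite eq_le sd andbT -lee_fin -Ks diam_ub.
have [l [l3 lK lcov]] : exists l : seq R[i], [/\ (size l <= 3)%N,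
    forall y, y \in l -> K y & K `<=` [set z | exists2 y, y \in l & disc y s z]].
  have [[p0 K0]|nK] := pselect (exists p, K p); last first.
    by exists [::]; split => // z Kz; case: nK; exists z.
  have [C0|/existsNP[p1 /not_implyP[K1 D01]]] := pselect (forall z, K z -> disc p0 s z).
    exists [:: p0]; split => // [y|z /C0 Cz]; first by rewrite inE => /eqP ->.
    by exists p0 => //; rewrite inE.
  have [C1|/existsNP[p2 /not_implyP[K2 /not_orP[D02 D12]]]] :=
      pselect (forall z, K z -> disc p0 s z \/ disc p1 s z).
    exists [:: p0; p1]; split => // [y|z /C1 []Cz].
    - by rewrite !inE => /orP[] /eqP ->.
    - by exists p0 => //; rewrite !inE eqxx.
    - by exists p1 => //; rewrite !inE eqxx orbT.
  exists [:: p0; p1; p2]; split => // [y|z Kz].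
    by rewrite !inE => /or3P[] /eqP ->.
  have [D0|D0] := pselect (disc p0 s z); first by exists p0; rewrite ?inE ?eqxx.
  have [D1|D1] := pselect (disc p1 s z); first by exists p1; rewrite ?inE ?eqxx ?orbT.
  have [D2|D2] := pselect (disc p2 s z); first by exists p2; rewrite ?inE ?eqxx ?orbT.
  by exfalso; apply: (@no_four_equidistant_points _ s p0 p1 p2 z) => //; exact: dist.
apply: (le_trans (hausdorff_measure_bigcup lcov d0)).
apply: (@le_trans _ _ (\sum_(y <- l) (a * s `^ d)%:E)%E).
  rewrite !big_seq; apply: lee_sum => y yl; apply: KA.2 => //; first exact: lK.
  by rewrite Ks.
rewrite sumEFin lee_fin big_const_seq count_predT iter_addr_0 -[_ *+ size l]mulr_natl -[3 * a * _]mulrA.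
by apply: ler_wpM2r; rewrite ?ler_nat // mulr_ge0 ?powR_ge0 ?ltW.
Qed.

(** For radii above the diameter, where the class condition is silent, the bound for the whole of
    [K] takes over, and [s < rho]. *)
Lemma class_A_disc_le (s rho : R) y : 0 < s -> diam K = s%:E -> 0 < rho -> K y ->
  (hausdorff_measure d (K `&` disc y rho) <= (3 * a * rho `^ d)%:E)%E.
Proof.
move=> s0 Ks rho0 Ky; have [rs|sr] := leP rho s.
  apply: (le_trans (KA.2 y rho Ky rho0 _)); first by rewrite Ks.
  rewrite lee_fin -mulrA ler_peMl ?mulr_ge0 ?powR_ge0 ?ltW //; lra.
apply: (@le_trans _ _ (hausdorff_measure d K)).
  by apply: le_hausdorff_measure => z [].
apply: (le_trans (class_A_measure_le s0 Ks)); rewrite lee_fin.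
apply: ler_wpM2l; first by rewrite mulr_ge0 ?(ltW a0).
apply: ge0_ler_powR; rewrite ?nnegrE ?(ltW d0) ?(ltW s0) ?(ltW rho0) ?(ltW sr) //.
Qed.

(** A set of diameter zero has measure zero, so [eps > 0] forces a positive diameter. *)
Lemma class_A_diam (eps t : R) x : 0 < eps -> K `<=` disc x t ->
  (eps%:E <= hausdorff_measure d K)%E ->
  exists2 s : R, 0 < s <= 2 * t & diam K = s%:E.
Proof.
move=> e0 Kt He.
have [t0|t0] := ltP t 0.
  move: He; rewrite hausdorff_measure_small ?lee_fin ?leNgt ?e0 //.
  apply/eqP; rewrite eq_le diam_ge0 andbT diam_le // => p q /Kt.
  by rewrite /disc /= ltNge (le_trans (ltW t0)) ?normc_ge0.
have Dt : (diam K <= (2 * t)%:E)%E.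
  apply: diam_le; first lra.
  move=> p q /Kt Kp /Kt Kq; apply: (le_trans (normc_triangle x p q)).
  move: Kp Kq; rewrite /disc /= [normc (q - x)]normc_distC; lra.
have Df : diam K \is a fin_num.
  by rewrite ge0_fin_numE ?diam_ge0 // (le_lt_trans Dt) // ltry.
exists (fine (diam K)); last by rewrite fineK.
rewrite -[X in _ && X]lee_fin fineK // Dt andbT.
rewrite lt_neqAle fine_ge0 ?diam_ge0 // andbT; apply/eqP => /esym D0.
have : diam K = 0%E by rewrite -(fineK Df) D0.
by move/(hausdorff_measure_small d0) => H0; move: He; rewrite H0 lee_fin leNgt e0.
Qed.

End ClassA.

(** * Logarithms as sums over geometric scales *)

Section Layers.
Context {R : realType}.

Lemma bernoulli_expr (lam : R) n : 1 <= lam -> 1 + n%:R * (lam - 1) <= lam ^+ n.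
Proof.
move=> l1; elim: n => [|n IH]; first by rewrite expr0; lra.
rewrite exprS; apply: (@le_trans _ _ (lam * (1 + n%:R * (lam - 1)))); last first.
  by apply: ler_wpM2l => //; lra.
rewrite -natr1 -subr_ge0.
have -> : lam * (1 + n%:R * (lam - 1)) - (1 + (n%:R + 1) * (lam - 1)) =
    n%:R * (lam - 1) ^+ 2 by ring.
by rewrite mulr_ge0 // sqr_ge0.
Qed.

(** Each radius [S / lam ^+ j] larger than [rho] accounts for one [ln lam] in [ln (S / rho)]. The
    lower bound on [rho] makes [J] radii enough: if all of them exceed [rho], the right side is
    [ln (lam ^+ J)]. *)
Lemma ln_layer_cake (lam S rho : R) J : 1 < lam -> 0 < S -> S / lam ^+ J <= rho ->
  ln (S / rho) <= ln lam * \sum_(j < J) (rho < S / lam ^+ j)%R%:R.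
Proof.
move=> l1 S0; have l0 : 0 < lam by lra.
have lnl : 0 <= ln lam by apply: ln_ge0; lra.
elim: J => [|J IH].
  rewrite expr0 divr1 big_ord0 mulr0 => Sr; apply: ln_le0.
  by rewrite ler_pdivrMr ?mul1r //; lra.
have [/IH {}IH _|rJ Sr] := leP (S / lam ^+ J) rho.
  by apply: (le_trans IH); rewrite big_ord_recr /= mulrDr lerDl mulr_ge0.
have r0 : 0 < rho by apply: lt_le_trans Sr; rewrite divr_gt0 ?exprn_gt0.
have -> : \sum_(j < J.+1) (rho < S / lam ^+ j)%R%:R = J.+1%:R :> R.
  rewrite (eq_bigr (fun=> 1)) ?sumr_const ?card_ord // => j _.
  rewrite (lt_le_trans rJ) // ler_wpM2l ?(ltW S0) // lef_pV2 ?posrE ?exprn_gt0 //.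
  by rewrite ler_eXn2l // -ltnS.
rewrite mulr_natr -lnXn // ler_ln ?posrE ?exprn_gt0 ?divr_gt0 //.
by rewrite ler_pdivrMr // mulrC -ler_pdivrMr ?exprn_gt0.
Qed.

(** With [k] the first exponent such that [2 ^- k <= m], the first [k] terms are at most [m] and the
    others form a geometric tail of sum at most [2 * 2 ^- k <= 2 * m]; minimality gives k <= 1 +
    log_2 (1 / m). The bound is free of [J], hence of the resolution of the net. *)
Lemma sum_min_geometric (m : R) J : 0 < m -> m <= 1 ->
  \sum_(j < J) Num.min m (2 ^- j) <= m * (3 + ln m^-1 / ln 2).
Proof.
move=> m0 m1; have ln2 : 0 < ln 2 :> R by apply: ln_gt0; lra.
have [k [k2 kle]] : exists k, 2 ^- k <= m /\ k%:R <= 1 + ln m^-1 / ln 2.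
  have ex : exists k, 2 ^- k <= m.
    exists (Num.bound `|m^-1|); rewrite -[leRHS]invrK lef_pV2 ?posrE ?invr_gt0 ?exprn_gt0 //.
    apply: ltW; apply: (le_lt_trans (real_ler_norm (num_real _))).
    apply: (lt_trans (archi_boundP _)) => //.
    by rewrite -natrX ltr_nat ltn_expl.
  have := ex_minnP ex; case=> k k2 kmin; exists k; split=> //; case: k k2 kmin => [|k] k2 kmin.
    by rewrite addr_ge0 // divr_ge0 ?(ltW ln2) // ln_ge0 // invf_ge1.
  have {}kmin : m < 2 ^- k by rewrite ltNge; apply/negP => /kmin; rewrite ltnn.
  rewrite -natr1 addrC lerD2l ler_pdivlMr // mulr_natl -lnXn // ler_ln ?posrE ?invr_gt0 ?exprn_gt0 //.
  by rewrite -[leLHS]invrK lef_pV2 ?posrE ?invr_gt0 ?exprn_gt0 // ltW.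
have p2 j : 0 < 2 ^- j :> R by rewrite invr_gt0 exprn_gt0.
have bnd l : \sum_(j < k + l) Num.min m (2 ^- j) <= k%:R * m + 2 * 2 ^- k * (1 - 2 ^- l).
  elim: l => [|l IH].
    rewrite addn0 expr0 invr1 subrr mulr0 addr0 mulr_natl.
    apply: (@le_trans _ _ (\sum_(j < k) m)); last by rewrite sumr_const card_ord.
    by apply: ler_sum => j _; rewrite ge_min lexx.
  rewrite addnS big_ord_recr /=.
  have h : Num.min m (2 ^- (k + l)) <= 2 ^- k * 2 ^- l by rewrite ge_min exprD invfM lexx orbT.
  have -> : 2 ^- l.+1 = 2 ^- l / 2 :> R by rewrite exprSr invfM.
  by move: IH h (p2 k) (p2 l); set A := \sum_(_ < _) _; set B := Num.min _ _; nra.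
apply: (@le_trans _ _ (\sum_(j < k + J) Num.min m (2 ^- j))).
  rewrite -(big_mkord predT (fun j => Num.min m (2 ^- j))).
  rewrite -(big_mkord predT (fun j => Num.min m (2 ^- j))).
  rewrite [leRHS](big_cat_nat (n := J)) ?leq_addl //= lerDl sumr_ge0 // => j _.
  by rewrite le_min (ltW m0) (ltW (p2 j)).
apply: (le_trans (bnd J)).
have : 2 * 2 ^- k * (1 - 2 ^- J) <= 2 * m :> R.
  by have := p2 J; have := p2 k; nra.
nra.
Qed.

End Layers.

Section Topology.
Local Open Scope complex_scope.
Context {R : realType}.

(** The norm of [R[i]^o] takes values in [R[i]]; a positive radius there has zero imaginary part, so
    real radii describe the neighbourhoods. *)
Lemma near_normcP (z : R[i]) (P : set R[i]) :
  (\forall w \near (z : R[i]^o), P w) <->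
  exists2 e : R, 0 < e & forall w, normc (w - z) < e -> P w.
Proof.
have E (w : R[i]) (e : R) : (`|(z : R[i]^o) - w| < e%:C) = (normc (w - z) < e).
  by rewrite distrC normc_def ltcR; case: (w - z).
split=> [/nbhs_ballP[e /= e0 eP]|[e e0 eP]]; last first.
  apply/nbhs_ballP; exists e%:C; first by rewrite /= ltcR.
  by move=> w; rewrite -ball_normE /ball_ /= E => /eP.
have er : e = (complex.Re e)%:C.
  by move: e0; case: (e) => er ei; rewrite ltcE /= => /andP[/eqP -> _].
exists (complex.Re e); first by move: e0; rewrite er ltcR.
by move=> w we; apply: eP; rewrite -ball_normE /ball_ /= er E.
Qed.

Lemma compact_finite_net (K : set R[i]) (e : R) : compact (K : set R[i]^o) -> 0 < e ->
  exists s : seq R[i], (forall p, p \in s -> K p) /\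
    K `<=` [set z | exists2 p, p \in s & disc p e z].
Proof.
move=> /compact_near_coveringP Kc e0.
(* Finite lists directed by inclusion: a property holds eventually if it holds for all lists
   containing some list [s0] of points of [K]. *)
pose F : set_system (seq R[i]) := [set Q | exists2 s0 : seq R[i], (forall p, p \in s0 -> K p) &
  forall s : seq R[i], {subset s0 <= s} -> Q s].
have FF : Filter F.
  split; first by exists [::].
  - move=> P Q [s1 K1 P1] [s2 K2 Q2]; exists (s1 ++ s2).
      by move=> p; rewrite mem_cat => /orP[/K1|/K2].
    move=> s s12; split; [apply: P1|apply: Q2] => p ps; apply: s12.
      by rewrite mem_cat ps.
    by rewrite mem_cat ps orbT.
  - by move=> P Q PQ [s1 K1 P1]; exists s1 => // s /P1 /PQ.
have [|s Ks sP] := Kc _ F (fun (s : seq R[i]) (z : R[i]) => exists2 p, p \in s & disc p e z) FF.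
  move=> z Kz.
  exists ([set w | disc z e w], [set s : seq R[i] | z \in s]).
    split=> /=; first by apply/near_normcP; exists e.
    exists [:: z] => [p|s /(_ z)]; first by rewrite inE => /eqP ->.
    by rewrite inE eqxx => /(_ isT).
  by move=> [w s] /= [zw zs]; exists z.
by exists s; split=> //; exact: sP.
Qed.

End Topology.

Section Frostman.
Local Open Scope complex_scope.
Context {R : realType}.

(* The masses [m] are maximal under the constraint that a disc of radius
   [2 * s_j] about a point of a fine net of [K] has mass at most [2 ^- j], where
   [s_j = 4 t 2 ^ (- j / d)], so that [s_j `^ d] halves at each step.  By
   maximality every point lies in a saturated disc; a disjoint Vitali subfamily of
   these, enlarged, covers [K], and class [A(d, a)] bounds the total mass below. *)
Lemma discrete_frostman (d a eps : R) (K : set R[i]) (x : R[i]) (t eta0 : R) :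
  0 < d -> 0 < a -> 0 < eps -> 0 < t -> 0 < eta0 ->
  K `<=` disc x t -> class_A d a K -> (eps%:E <= hausdorff_measure d K)%E ->
  exists n (p : 'I_n -> R[i]) (m : 'I_n -> R) (eta : R),
  [/\ forall i, K (p i), 0 < eta <= eta0, forall i, 0 <= m i,
      \sum_i m i = 1 &
      forall z, (forall i, eta <= normc (z - p i)) ->
        \sum_i m i * ln (4 * t / normc (z - p i)) <=
        (ln 24 + ln (a * t `^ d / eps)) / d + ln 28].
Proof.
move=> d0 a0 e0 t0 eta00 Kt KA He.
have [s0 /andP[s00 s02t] Ks] := class_A_diam d0 e0 Kt He.
pose lam : R := 2 `^ d^-1.
have lam1 : 1 < lam.
  rewrite -[ltLHS](congr1 (fun g => g d^-1) (powR1 R)).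
  by apply: gt0_ltr_powR; rewrite ?nnegrE ?invr_gt0 //; lra.
have lam0 : 0 < lam by lra.
have lamd : lam `^ d = 2 by rewrite /lam -powRrM mulVf ?gt_eqF // powRr1.
have lnlam : ln lam = ln 2 / d by rewrite /lam ln_powR mulrC.
pose sc j := 4 * t / lam ^+ j.
have t4 : 0 < 4 * t by rewrite mulr_gt0.
have sc0 j : 0 < sc j by rewrite divr_gt0 // exprn_gt0.
have scd j : sc j `^ d = (4 * t) `^ d * 2 ^- j.
  rewrite /sc powRM ?invr_ge0 ?exprn_ge0 ?(ltW t4) ?(ltW lam0) //; congr (_ * _).
  by rewrite -powR_invn ?(ltW lam0) // powRAC lamd powR_invn.
have sc_le i j : (i <= j)%N -> sc j <= sc i.
  move=> ij; rewrite ler_wpM2l ?(ltW t4) // lef_pV2 ?posrE ?exprn_gt0 //.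
  by rewrite ler_eXn2l.
(* The finest scale [sc J] is also the mesh of the net and the final [eta]. *)
have [J scJ] : exists J, sc J <= eta0.
  exists (Num.bound (4 * t / eta0 / (lam - 1))).
  rewrite /sc ler_pdivrMr ?exprn_gt0 // [leRHS]mulrC -ler_pdivrMr //.
  apply: (le_trans _ (bernoulli_expr _ (ltW lam1))).
  apply: (@le_trans _ _ ((Num.bound (4 * t / eta0 / (lam - 1)))%:R * (lam - 1))); last lra.
  rewrite -ler_pdivrMr ?subr_gt0 //; apply: ltW; apply: archi_boundP.
  by rewrite !divr_ge0 ?subr_ge0 ?(ltW t4) ?(ltW eta00) ?(ltW lam1).
have [s [sK Kcov]] := compact_finite_net KA.1 (sc0 J).
pose n := size s; pose p (i : 'I_n) := nth 0 s i.
have pK i : K (p i) by apply/sK/mem_nth.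
pose S (k : 'I_n * 'I_J.+1) : {set 'I_n} :=
  finset (fun i : 'I_n => normc (p i - p k.1) < 2 * sc k.2).
have SE k i : (i \in S k) = (normc (p i - p k.1) < 2 * sc k.2) by rewrite finset.in_set.
have b0 (k : 'I_n * 'I_J.+1) : 0 <= 2 ^- k.2 :> R by rewrite invr_ge0 exprn_ge0.
have Scov i : exists k, i \in S k.
  by exists (i, ord0); rewrite SE /= subrr Normc.normc0 mulr_gt0.
have [m [m0 mS mt]] := greedy_tight_weights b0 Scov.
pose M := \sum_i m i.
have SM (A : {set 'I_n}) : \sum_(i in A) m i <= M.
  by rewrite /M [leRHS](bigID (mem A)) /= lerDl sumr_ge0.
pose tight (k : 'I_n * 'I_J.+1) := \sum_(i in S k) m i == 2 ^- k.2.
have [D [Dt Dd DP]] := vitali_selection (fun k : 'I_n * 'I_J.+1 => nat_of_ord k.2)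
  (fun k l => fintype.disjoint (mem (S k)) (mem (S l))) [seq k <- enum {: 'I_n * 'I_J.+1} | tight k].
have {}Dt k : k \in D -> \sum_(i in S k) m i = 2 ^- k.2.
  by move=> /Dt; rewrite mem_filter => /andP[/eqP].
have Dsum : \sum_(k <- D) \sum_(i in S k) m i <= M.
  under eq_bigr do rewrite big_mkcond /=.
  rewrite exchange_big; apply: ler_sum => i _.
  elim: (D) Dd => [|k l IH] /=; first by rewrite big_nil.
  case/andP=> /allP kl /IH {}IH; rewrite big_cons.
  case: ifPn => ik; last by rewrite add0r.
  rewrite big1_seq ?addr0 // => k' /andP[_ /kl dk].
  by rewrite (disjointFr dk ik).
have Mge : eps / (3 * a * (28 * t) `^ d) <= M.
  rewrite ler_pdivrMr ?mulr_gt0 ?powR_gt0 ?mulr_gt0 // -lee_fin.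
  pose ball (k : 'I_n * 'I_J.+1) := disc (p k.1) (7 * sc k.2).
  have cov : K `<=` [set z | exists2 k, k \in D & ball k z].
    move=> z /Kcov [q qs zq].
    have qn : (index q s < n)%N by rewrite index_mem.
    have pq : p (Ordinal qn) = q by rewrite /p /= nth_index.
    have [k ik /eqP kt] := mt (Ordinal qn).
    have [|y yD /andP[yk]] := DP k; first by rewrite mem_filter /tight kt mem_enum.
    have /= scyk := sc_le _ _ yk.
    have scyJ : sc J <= sc y.2 by apply: sc_le; rewrite -ltnS.
    have /= scy := sc0 y.2.
    move: ik zq; rewrite SE pq /disc /= => ik zq kdy; exists y => //.
    (* From [z] to its net point, to the centre of the saturated disc, to a common point, to the
       centre [p y.1]: less than 1 + 2 + 2 + 2 times [sc y.2], since the lower level has the larger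
       radius. *)
    rewrite /ball /disc /=; apply: (le_lt_trans (normc_triangle q _ _)).
    have [yeq|] := eqVneq y k; first by rewrite yeq in scyJ scy *; lra.
    move: kdy => /predU1P[->|]; first by rewrite eqxx.
    rewrite -finset.setI_eq0 => /finset.set0Pn[l]; rewrite finset.in_setI !SE => /andP[ly lk] _.
    have := normc_triangle (p k.1) q (p y.1).
    have := normc_triangle (p l) (p k.1) (p y.1).
    move: lk; rewrite [normc (p k.1 - p l)]normc_distC; lra.
  apply: (le_trans He); apply: (le_trans (hausdorff_measure_bigcup cov d0)).
  apply: (@le_trans _ _ (\sum_(k <- D) (3 * a * (28 * t) `^ d * 2 ^- k.2)%:E)%E).
    apply: lee_sum => k _; rewrite /ball.
    apply: (le_trans (class_A_disc_le d0 a0 KA s00 Ks _ (pK k.1))).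
      by rewrite mulr_gt0.
    have -> : (28 * t) `^ d = 7 `^ d * (4 * t) `^ d.
      rewrite -powRM ?(ltW t4) //; congr (_ `^ _); ring.
    by rewrite lee_fin powRM ?(ltW (sc0 _)) // scd !mulrA.
  rewrite sumEFin lee_fin -mulr_sumr mulrC ler_wpM2r ?mulr_ge0 ?powR_ge0 ?(ltW a0) //.
  by apply: le_trans Dsum; rewrite !big_seq; apply: ler_sum => k /Dt ->.
have M0 : 0 < M.
  by apply: lt_le_trans Mge; rewrite divr_gt0 // !mulr_gt0 ?powR_gt0 ?mulr_gt0.
(* The constraint at level 0 concerns a disc of radius [8 * t], which contains all net points. *)
have M1 : M <= 1.
  have [i0 _|n0] := pickP 'I_n; last by rewrite /M big_pred0.
  have := mS (i0, ord0); rewrite /= expr0 invr1; apply: le_trans.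
  rewrite /M [leLHS](bigID (mem (S (i0, ord0)))) /= gerDl.
  rewrite big_pred0 // => i; apply/negbTE; rewrite negbK SE /= /sc expr0 divr1.
  apply: (le_lt_trans (normc_triangle x _ _)).
  have := Kt _ (pK i); have := Kt _ (pK i0); rewrite /disc /= [normc (x - _)]normc_distC.
  lra.
exists n, p, (fun i => m i / M), (sc J); split=> //.
- by rewrite sc0.
- by move=> i; rewrite divr_ge0 // ltW.
- by rewrite -mulr_suml divff // gt_eqF.
move=> z zJ.
(* Net points within [sc j] of an arbitrary [z] are within [2 * sc j] of any one of them; this is
   why the discs in [S] have doubled radii. *)
have mass j : (j <= J)%N ->
    \sum_i m i * (normc (z - p i) < sc j)%R%:R <= Num.min M (2 ^- j).
  move=> jJ.
  have -> : \sum_i m i * (normc (z - p i) < sc j)%R%:R =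
      \sum_(i in finset (fun i => normc (z - p i) < sc j)) m i.
    rewrite [RHS]big_mkcond; apply: eq_bigr => i _; rewrite finset.in_set.
    by case: ifP; rewrite ?mulr1 ?mulr0.
  rewrite le_min SM /=.
  have [i0 i0z|noi] := pickP (fun i => normc (z - p i) < sc j); last first.
    rewrite big_pred0 ?invr_ge0 ?exprn_ge0 // => i; rewrite finset.in_set; exact: noi.
  have jJ1 : (j < J.+1)%N by [].
  apply: le_trans (mS (i0, Ordinal jJ1)).
  rewrite [leRHS](bigID (mem (finset (fun i => normc (z - p i) < sc j)))) /=.
  rewrite -[leLHS]addr0; apply: lerD; last exact: sumr_ge0.
  rewrite le_eqVlt; apply/orP; left; apply/eqP; apply: eq_bigl => i.
  rewrite andbC; case: (boolP (i \in _)) => //=; rewrite finset.in_set => iz.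
  rewrite SE /=; apply/esym; apply: (le_lt_trans (normc_triangle z _ _)).
  move: i0z iz; rewrite [normc (p i - z)]normc_distC; lra.
(* Exchanging the sums turns the potential into a sum over scales of masses of discs about [z]. The
   factor [M] in front disappears when the masses are normalised. *)
have pot : \sum_i m i * ln (4 * t / normc (z - p i)) <= M * ((3 * ln 2 + ln M^-1) / d).
  have ln2 : 0 < ln 2 :> R by apply: ln_gt0; lra.
  apply: (@le_trans _ _ (\sum_i m i * (ln lam * \sum_(j < J) (normc (z - p i) < sc j)%R%:R))).
    by apply: ler_sum => i _; apply: ler_wpM2l => //; apply: ln_layer_cake.
  have -> : \sum_i m i * (ln lam * \sum_(j < J) (normc (z - p i) < sc j)%R%:R) =
     ln lam * \sum_(j < J) \sum_i m i * (normc (z - p i) < sc j)%R%:R.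
    rewrite exchange_big /= mulr_sumr; apply: eq_bigr => i _.
    by rewrite mulrCA -mulr_sumr.
  apply: (@le_trans _ _ (ln lam * (M * (3 + ln M^-1 / ln 2)))).
    apply: ler_wpM2l; first by rewrite ln_ge0 // ltW.
    apply: le_trans (sum_min_geometric J M0 M1); apply: ler_sum => j _.
    by apply: mass; rewrite ltnW.
  rewrite lnlam le_eqVlt; apply/orP; left; apply/eqP; field.
  by rewrite !gt_eqF.
have Minv : ln M^-1 <= ln 3 + ln (a * t `^ d / eps) + d * ln 28.
  have tp : 0 < t `^ d by apply: powR_gt0.
  have Tp : 0 < 28 `^ d :> R by apply: powR_gt0.
  rewrite -ln_powR -!lnM ?posrE ?mulr_gt0 ?invr_gt0 //.
  rewrite ler_ln ?posrE ?mulr_gt0 ?invr_gt0 //.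
  rewrite -[leRHS]invrK lef_pV2 ?posrE ?invr_gt0 ?mulr_gt0 ?invr_gt0 //.
  apply: le_trans Mge; rewrite powRM ?(ltW t0) //.
  rewrite le_eqVlt; apply/orP; left; apply/eqP; field.
  by rewrite !gt_eqF.
have -> : \sum_i m i / M * ln (4 * t / normc (z - p i)) =
    (\sum_i m i * ln (4 * t / normc (z - p i))) / M.
  by rewrite mulr_suml; apply: eq_bigr => i _; rewrite mulrAC.
rewrite ler_pdivrMr // [leRHS]mulrC; apply: (le_trans pot); rewrite ler_wpM2l ?(ltW M0) //.
have ln24 : ln 24 = 3 * ln 2 + ln 3 :> R.
  rewrite mulr_natl -lnXn // -lnM ?posrE // ?exprn_gt0 //; congr ln; ring.
rewrite ler_pdivrMr // [leRHS]mulrDl [X in _ <= X + _]divfK ?gt_eqF // ln24; lra.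
Qed.
End Frostman.

(** * Comparison with sums of Blaschke logarithms *)

Section Touching.
Local Open Scope complex_scope.
Context {R : realType}.

Lemma normc_le_abs (u v : R) : normc (u +i* v) <= `|u| + `|v|.
Proof.
rewrite -(@ler_pXn2r _ 2%N) ?nnegrE ?normc_ge0 ?addr_ge0 // sqr_normc.
rewrite -(real_normK (num_real u)) -(real_normK (num_real v)).
have := normr_ge0 u; have := normr_ge0 v; nra.
Qed.

Lemma circle_pointE (z : R[i]) (rho theta : R) :
  circle_point z rho theta = z + (rho * cos theta +i* (rho * sin theta)).
Proof.
rewrite /circle_point; congr (_ + _); apply/eqP; rewrite eq_complex /=.
by rewrite !mul0r subr0 addr0 !eqxx.
Qed.

Lemma continuous_trig_poly (A a b c e : R) : continuous (fun x : R =>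
  A + a * cos x + b * sin x + c * (cos x ^+ 2 - sin x ^+ 2)
    + e * (cos x * sin x)).
Proof.
move=> x.
pose h : R -> R := cst A + a \*: cos + b \*: sin + c \*: (cos * cos - sin * sin)
  + e \*: (cos * sin).
rewrite (_ : (fun _ => _) = h); last first.
  by apply/funext => y; rewrite /h !fctE /= /GRing.scale /= !expr2.
apply: differentiable_continuous; apply/derivable1_diffP.
exact: ex_derive.
Qed.

(** Apart from [A], the terms are traces on a circle of harmonic polynomials of degree one and two;
    their antiderivatives, multiples of [sin], [cos], [sin * cos] and [sin * sin], agree at 0 and
    [2 * pi]. *)
Lemma integral_trig_poly (A a b c e : R) :
  (\int[lebesgue_measure]_(theta in `[0%R, (2 * pi)%R])
    (A + a * cos theta + b * sin theta + c * (cos theta ^+ 2 - sin theta ^+ 2)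
       + e * (cos theta * sin theta))%:E = (2 * pi * A)%:E)%E.
Proof.
have pi0 : (0 : R) < 2 * pi by rewrite mulr_gt0 // pi_gt0.
pose q (x : R) : R := A + a * cos x + b * sin x + c * (cos x ^+ 2 - sin x ^+ 2)
  + e * (cos x * sin x).
pose G : R -> R := A \*: id + a \*: sin - b \*: cos + c \*: (sin * cos)
  + (e / 2) \*: (sin * sin).
have dG (x : R) : is_derive x 1 G (q x).
  apply: is_derive_eq; rewrite /q /= /GRing.scale /=; lra.
have cG x : {for x, continuous G}.
  by apply: differentiable_continuous; apply/derivable1_diffP; case: (dG x).
rewrite (@continuous_FTC2 _ q G) //.
- by rewrite -EFinB /G !fctE /= [2 * pi]mulr_natl cos2pi sin2pi cos0 sin0 /GRing.scale /=; congr EFin; ring.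
- apply: continuous_subspaceT => x; exact: continuous_trig_poly.
- split.
  + by move=> x _; case: (dG x).
  + exact/cvg_at_right_filter/cG.
  + exact/cvg_at_left_filter/cG.
- move=> x _; rewrite derive1E; case: (dG x) => _ <- //.
Qed.

(** Along the circle [- f] is lower semicontinuous, hence Borel; monotonicity of the integral can
    then be applied to [f]. *)
Lemma subharmonic_circle_measurable U (f : R[i] -> \bar R) (z : R[i]) (rho : R) :
  subharmonic_on U f -> 0 < rho -> cdisc z rho `<=` U ->
  measurable_fun [set: R] (fun theta : R => f (circle_point z rho theta)).
Proof.
move=> [_ usc _] rho0 zU.
suff lsc : lower_semicontinuous (fun theta => - f (circle_point z rho theta))%E.
  rewrite (_ : (fun _ => _) = -%E \o (fun theta : R => - f (circle_point z rho theta))%E).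
    apply: measurableT_comp; first exact: oppe_measurable.
    exact: lower_semicontinuous_measurable.
  by apply/funext => theta /=; rewrite oppeK.
move=> x a; rewrite lteNr -EFinN => fa.
have xU : U (circle_point z rho x).
  apply: zU; rewrite /cdisc /= circle_pointE addrC addKr normcE.
  by rewrite !exprMn -mulrDr cos2Dsin2 mulr1 sqrtr_sqr gtr0_norm.
have [e e0 eP] := (near_normcP _ _).1 (usc _ _ xU fa).
have cts g : continuous g -> \forall y \near x, `|rho * g x - rho * g y| < e / 2.
  move=> cg; have : (rho * g y) @[y --> x] --> rho * g x by apply: cvgMr; exact: cg.
  by move=> /cvgr_dist_lt; apply; rewrite divr_gt0.
exists [set y | (a%:E < - f (circle_point z rho y))%E] => //.
near=> y; rewrite /= lteNr -EFinN; apply: eP; rewrite !circle_pointE.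
have -> : z + (rho * cos y +i* (rho * sin y)) - (z + (rho * cos x +i* (rho * sin x))) =
   (rho * cos y - rho * cos x) +i* (rho * sin y - rho * sin x).
  by rewrite opprD addrACA subrr add0r.
apply: (le_lt_trans (normc_le_abs _ _)); rewrite [e]splitr; apply: ltrD.
  by rewrite distrC; near: y; apply: cts; exact: continuous_cos.
by rewrite distrC; near: y; apply: cts; exact: continuous_sin.
Unshelve. all: by end_near. Qed.

(* Averaging the upper bound over the circle of radius [rho] leaves
   [F - k * rho ^+ 2 < f z]. *)
Lemma subharmonic_touch U (f : R[i] -> \bar R) (z : R[i]) (F a b c e k rho : R) :
  subharmonic_on U f -> 0 < rho -> 0 < k -> cdisc z rho `<=` U -> f z = F%:E ->
  (forall u v : R, u ^+ 2 + v ^+ 2 <= rho ^+ 2 -> (f (z + (u +i* v)%C)%R <=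
     (F + a * u + b * v + c * (u ^+ 2 - v ^+ 2) + e * (u * v)
        - k * (u ^+ 2 + v ^+ 2))%:E)%E) -> False.
Proof.
move=> sf rho0 k0 zU fz touch.
have [_ _ /(_ z rho rho0 zU)] := sf; rewrite fz; apply/negP; rewrite -ltNge.
have pi0 : (0 : R) < 2 * pi by rewrite mulr_gt0 // pi_gt0.
pose g (x : R) : R := (F - k * rho ^+ 2) + (a * rho) * cos x + (b * rho) * sin x
  + (c * rho ^+ 2) * (cos x ^+ 2 - sin x ^+ 2) + (e * rho ^+ 2) * (cos x * sin x).
have fg x : (f (circle_point z rho x) <= (g x)%:E)%E.
  have cs : cos x ^+ 2 + sin x ^+ 2 = 1 by exact: cos2Dsin2.
  rewrite circle_pointE; apply: (le_trans (touch _ _ _)).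
    by rewrite !exprMn -mulrDr cs mulr1.
  rewrite lee_fin le_eqVlt; apply/orP; left; apply/eqP.
  rewrite /g -[X in _ = F - X + _ + _ + _ + _]mulr1 -cs; ring.
apply: (@le_lt_trans _ _ ((2 * pi)^-1%:E *
    \int[lebesgue_measure]_(x in `[0%R, (2 * pi)%R]) (g x)%:E)%E); last first.
  rewrite integral_trig_poly -EFinM lte_fin mulKf ?gt_eqF //.
  by rewrite gtrDl oppr_lt0 mulr_gt0 // exprn_gt0.
apply: lee_wpmul2l; first by rewrite lee_fin invr_ge0 ltW.
have mf := subharmonic_circle_measurable sf rho0 zU.
have mg : measurable_fun setT (EFin \o g).
  apply/measurable_EFinP; apply: continuous_measurable_fun => x.
  exact: continuous_trig_poly.
(* [f] may have integral -oo, so positive and negative parts are compared separately. *)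
rewrite integralE [leRHS]integralE; apply: leeB.
- apply: ge0_le_integral => //.
  + by apply: measurable_funTS; apply: measurable_funepos.
  + by apply: measurable_funTS; apply: measurable_funepos.
  + by move=> x _; rewrite !funeposE ge_max !le_max /= fg lexx orbT.
- apply: ge0_le_integral => //.
  + by apply: measurable_funTS; apply: measurable_funeneg.
  + by apply: measurable_funTS; apply: measurable_funeneg.
  + by move=> x _; rewrite !funenegE ge_max !le_max leeN2 fg lexx orbT.
Qed.
End Touching.

Section UpperSemicontinuous.
Context {R : realType} {T : topologicalType}.

(** If the supremum [s] were not attained, each point would have a neighbourhood on which [u] stays
    below some number less than [s]. Compactness, with the left neighbourhoods of [s] as parameter
    filter, makes that number uniform, against the definition of [s]. The bounds [b0] and [b1] make
    [s] finite. *)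
Lemma usc_attains_max (K : set T) (u : T -> \bar R) (b0 b1 : R) (z0 : T) :
  compact K -> K z0 -> (b0%:E <= u z0)%E -> (forall z, K z -> (u z <= b1%:E)%E) ->
  (forall z (b : R), K z -> (u z < b%:E)%E -> \forall w \near z, K w -> (u w < b%:E)%E) ->
  exists2 z1, K z1 & forall w, K w -> (u w <= u z1)%E.
Proof.
move=> /compact_near_coveringP/near_covering_withinP Kc K0 u0 ub usc.
pose s := ereal_sup (u @` K).
have us z : K z -> (u z <= s)%E by move=> Kz; apply: ereal_sup_ubound; exists z.
have sfin : s \is a fin_num.
  rewrite fin_numElt; apply/andP; split.
    by apply: lt_le_trans (us _ K0); apply: lt_le_trans u0; rewrite ltNyr.
  apply: (@le_lt_trans _ _ b1%:E); last by rewrite ltry.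
  by apply: ge_ereal_sup => _ [z Kz <-]; exact: ub.
have [[z Kz uz]|nmax] := pselect (exists2 z, K z & u z = s).
  by exists z => // w Kw; rewrite uz us.
exfalso; have usl z : K z -> (u z < s)%E.
  by move=> Kz; rewrite lt_neqAle us // andbT; apply/eqP => uz; apply: nmax; exists z.
have := Kc R (at_left (fine s)) (fun i z => (u z < i%:E)%E) _.
have H : forall x, K x -> \forall x' \near x & i \near (fine s)^'-, K x' -> (u x' < i%:E)%E.
  move=> z Kz; have [b /andP[zb bs]] : exists b : R, (u z < b%:E)%E && (b%:E < s)%E.
    have := usl _ Kz; rewrite -(fineK sfin).
    case: (u z) (us _ Kz) => [v||] // _ vs.
      exists ((v + fine s) / 2); move: vs; rewrite !lte_fin => vs; lra.
    by exists (fine s - 1); rewrite ltNyr lte_fin; lra.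
  exists ([set w | K w -> (u w < b%:E)%E], [set i | b < i]).
    split=> /=; first exact: usc.
    by apply: nbhs_left_gt; rewrite -lte_fin fineK.
  move=> [w i] /= [wb bi] /wb /lt_trans; apply; by rewrite lte_fin.
move=> /(_ _ H) near_s.
have [i [/= Ki ilt]] : exists i, K `<=` (fun z => (u z < i%:E)%E) /\ i < fine s.
  near (fine s)^'- => i; exists i; split; near: i; first exact: near_s.
  exact: nbhs_left_lt.
have : (s <= i%:E)%E by apply: ge_ereal_sup => _ [z Kz <-]; exact/ltW/Ki.
by apply/negP; rewrite -ltNge -(fineK sfin) lte_fin.
Unshelve. all: by end_near. Qed.

End UpperSemicontinuous.

(** * Second order expansions of logarithms of moduli *)

Section Taylor.
Local Open Scope complex_scope.
Context {R : realType}.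
Implicit Types (h : R[i] -> R) (z w : R[i]).

(* A second order expansion of [h] at [z] whose quadratic part is a harmonic
   polynomial plus [L * |w| ^ 2]; thus [L] is a quarter of the Laplacian. *)
Definition taylor2 h z (L : R) := exists a b c e : R, forall k : R, 0 < k ->
  exists2 rho : R, 0 < rho & forall u v : R, u ^+ 2 + v ^+ 2 <= rho ^+ 2 ->
    `|h (z + (u +i* v)) - (h z + a * u + b * v + c * (u ^+ 2 - v ^+ 2)
       + e * (u * v) + L * (u ^+ 2 + v ^+ 2))| <= k * (u ^+ 2 + v ^+ 2).

Lemma taylor2_cst (C : R) z : taylor2 (fun=> C) z 0.
Proof.
exists 0, 0, 0, 0 => k k0; exists 1 => // u v _.
by rewrite !mul0r !addr0 subrr normr0 mulr_ge0 ?(ltW k0) // addr_ge0 // sqr_ge0.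
Qed.

Lemma taylor2D h1 h2 z (L1 L2 : R) : taylor2 h1 z L1 -> taylor2 h2 z L2 ->
  taylor2 (fun w => h1 w + h2 w) z (L1 + L2).
Proof.
move=> [a1 [b1 [c1 [e1 H1]]]] [a2 [b2 [c2 [e2 H2]]]].
exists (a1 + a2), (b1 + b2), (c1 + c2), (e1 + e2) => k k0.
have k2 : 0 < k / 2 by lra.
have [r1 r10 {}H1] := H1 _ k2; have [r2 r20 {}H2] := H2 _ k2.
exists (Num.min r1 r2); first by rewrite lt_min r10.
move=> u v uv.
have m0 : 0 <= Num.min r1 r2 by rewrite le_min !ltW.
have uv1 : u ^+ 2 + v ^+ 2 <= r1 ^+ 2.
  by apply: (le_trans uv); rewrite lerXn2r ?nnegrE ?(ltW r10) // ge_min lexx.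
have uv2 : u ^+ 2 + v ^+ 2 <= r2 ^+ 2.
  by apply: (le_trans uv); rewrite lerXn2r ?nnegrE ?(ltW r20) // ge_min lexx orbT.
have := H2 _ _ uv2; set X2 := (X in `|X| <= _); move=> l2.
have := H1 _ _ uv1; set X1 := (X in `|X| <= _); move=> l1. rewrite [in leRHS](splitr k) [leRHS]mulrDl.
apply: (le_trans _ (lerD l1 l2)); apply: (le_trans _ (ler_normD _ _)).
by rewrite /X1 /X2 le_eqVlt; apply/orP; left; apply/eqP; congr `|_|; ring.
Qed.

Lemma taylor2Z h z (L m : R) : taylor2 h z L -> taylor2 (fun w => m * h w) z (m * L).
Proof.
move=> [a [b [c [e H]]]]; exists (m * a), (m * b), (m * c), (m * e) => k k0.
have km : 0 < k / (`|m| + 1) by rewrite divr_gt0 // ltr_pwDr.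
have [r r0 {}H] := H _ km; exists r => // u v uv; have := H _ _ uv.
set X := (X in `|X| <= _); move=> HX.
rewrite (_ : m * _ - _ = m * X); last by rewrite /X; ring.
rewrite normrM; apply: (le_trans (ler_wpM2l (normr_ge0 m) HX)).
rewrite mulrA ler_wpM2r ?addr_ge0 ?sqr_ge0 // mulrCA ger_pMr //.
rewrite ler_pdivrMr ?mul1r ?lerDl // ltr_pwDr //.
Qed.

Lemma taylor2_sum n (m : 'I_n -> R) (h : 'I_n -> R[i] -> R) z :
  (forall i, taylor2 (h i) z 0) -> taylor2 (fun w => \sum_i m i * h i w) z 0.
Proof.
move=> H; elim: n m h H => [|n IH] m h H.
  rewrite (_ : (fun _ => _) = (fun=> 0)); first exact: taylor2_cst.
  by apply/funext => w; rewrite big_ord0.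
rewrite (_ : (fun _ => _) = (fun w =>
    \sum_(i < n) m (lift ord_max i) * h (lift ord_max i) w + m ord_max * h ord_max w)).
  have := taylor2D (IH (fun i => m (lift ord_max i)) _ (fun i => H (lift ord_max i)))
    (taylor2Z (m ord_max) (H ord_max)).
  by rewrite mulr0 addr0.
apply/funext => w; rewrite big_ord_recr; congr (_ + _); apply: eq_bigr => i _.
by rewrite (_ : widen_ord _ i = lift ord_max i) //; apply/val_inj; rewrite /= /bump leqNgt ltn_ord.
Qed.

Lemma taylor2_sqr_normc z : taylor2 (fun w => normc w ^+ 2) z 1.
Proof.
case: z => x y; exists (2 * x), (2 * y), 0, 0 => k k0; exists 1 => // u v _.
have -> : (x +i* y) + (u +i* v) = ((x + u) +i* (y + v)) :> R[i] by [].
rewrite !sqr_normc (_ : _ - _ = 0); last by ring.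
by rewrite normr0 mulr_ge0 ?(ltW k0) // addr_ge0 // sqr_ge0.
Qed.

Lemma taylor2_continuous h z (L d : R) : taylor2 h z L -> 0 < d ->
  exists2 e : R, 0 < e & forall w, normc (w - z) < e -> `|h w - h z| < d.
Proof.
move=> [a [b [c [e /(_ 1 ltr01)[r r0 H]]]]] d0.
pose B := `|a| + `|b| + `|c| + `|e| + `|L| + 1.
have B0 : 0 < B by rewrite ltr_pwDr // !addr_ge0.
exists (Num.min (Num.min r 1) (d / (B + 1))).
  by rewrite !lt_min r0 ltr01 divr_gt0 // addr_gt0.
move=> w; rewrite !lt_min => /andP[/andP[wr w1] wd].
have : w = z + (w - z) by rewrite addrC subrK.
case: (w - z) wr w1 wd => u v; set s := normc _ => wr w1 wd wE.
have s0 : 0 <= s by exact: normc_ge0.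
have sE : u ^+ 2 + v ^+ 2 = s ^+ 2 by rewrite /s sqr_normc.
have ss : s ^+ 2 <= s by rewrite expr2 ler_piMl //; exact: ltW.
have us : `|u| <= s.
  rewrite -(@ler_pXn2r _ 2%N) ?nnegrE // -sE real_normK ?num_real //.
  by rewrite lerDl sqr_ge0.
have vs : `|v| <= s.
  rewrite -(@ler_pXn2r _ 2%N) ?nnegrE // -sE real_normK ?num_real //.
  by rewrite lerDr sqr_ge0.
have := H u v; rewrite sE -wE => Hw.
have {}/Hw Hw : s ^+ 2 <= r ^+ 2 by rewrite lerXn2r ?nnegrE // ltW.
have lin q y : `|y| <= s -> `|q * y| <= `|q| * s.
  by move=> ys; rewrite normrM ler_wpM2l.
have cs : `|u ^+ 2 - v ^+ 2| <= s.
  rewrite ler_norml; have := sqr_ge0 u; have := sqr_ge0 v; lra.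
have es : `|u * v| <= s.
  rewrite ler_norml; have := sqr_ge0 (u + v); have := sqr_ge0 (u - v).
  lra.
have Ls : `|s ^+ 2| <= s by rewrite ger0_norm // sqr_ge0.
have := lin a _ us; have := lin b _ vs; have := lin c _ cs; have := lin e _ es.
have := lin L _ Ls.
move=> l5 l4 l3 l2 l1.
apply: (@le_lt_trans _ _ (B * s)); last first.
  have B1 : 0 < B + 1 := addr_gt0 B0 ltr01.
  move: wd; rewrite ltr_pdivlMr //; apply: le_lt_trans.
  by rewrite mulrDr mulr1 mulrC lerDl.
rewrite (_ : h w - h z = (h w - (h z + a * u + b * v + c * (u ^+ 2 - v ^+ 2) + e * (u * v) +
         L * s ^+ 2)) + a * u + b * v + c * (u ^+ 2 - v ^+ 2) + e * (u * v) +
         L * s ^+ 2); last by ring.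
have nD (p q A C : R) : `|p| <= A -> `|q| <= C -> `|p + q| <= A + C.
  by move=> pA qC; exact: (le_trans (ler_normD _ _) (lerD pA qC)).
apply: (le_trans (nD _ _ _ _ (nD _ _ _ _ (nD _ _ _ _ (nD _ _ _ _
  (nD _ _ _ _ Hw l1) l2) l3) l4) l5)).
rewrite /B !mulrDl !mul1r; lra.
Qed.

(** In the variable y = 1 + x the remainder vanishes at 1 and has derivative (y - 1)^2 / y, at most
    2 x^2 since y >= 1/2; the mean value theorem between 1 and 1 + x supplies the third factor. *)
Lemma ln1D_taylor2 (x : R) : `|x| <= 1 / 2 ->
  `|ln (1 + x) - (x - x ^+ 2 / 2)| <= 2 * `|x| ^+ 3.
Proof.
pose q : R -> R := 2^-1 \*: (id * id) - 2 \*: id + cst (3 / 2).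
pose f : R -> R := fun y => ln y + q y.
pose df (y : R) : R := y^-1 + (y - 2).
have dfE (y : R) : 0 < y -> is_derive y 1 f (df y).
  move=> y0; have dq : is_derive y 1 q (y - 2).
    by apply: is_derive_eq; rewrite /GRing.scale /=; lra.
  exact: (@is_deriveD R R^o R^o (@ln R) q y 1 _ _ (is_derive1_ln y0) dq).
have f_cont (y : R) : 0 < y -> {for y, continuous f}.
  move=> y0; apply: differentiable_continuous; apply/derivable1_diffP.
  by case: (dfE y y0).
have f1 : f 1 = 0 by rewrite /f /q !fctE /= ln1 /GRing.scale /=; lra.
have fx : f (1 + x) = ln (1 + x) - (x - x ^+ 2 / 2).
  by rewrite /f /q !fctE /= /GRing.scale /=; lra.
rewrite -fx => x2.
have dfle (y : R) : `|y - 1| <= `|x| -> `|df y| <= 2 * `|x| ^+ 2.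
  move=> yx; have y2 : 1 / 2 <= y by have := le_trans yx x2; rewrite ler_norml; lra.
  have -> : df y = (y - 1) ^+ 2 / y by rewrite /df; field; rewrite gt_eqF //; lra.
  rewrite ger0_norm ?divr_ge0 ?sqr_ge0 //; last lra.
  rewrite -[(y - 1) ^+ 2]real_normK ?num_real // ler_pdivrMr; last lra.
  have : `|y - 1| ^+ 2 <= `|x| ^+ 2 by rewrite lerXn2r ?nnegrE.
  have := sqr_ge0 `|x|; nra.
have main c : `|c - 1| <= `|x| -> f (1 + x) = df c * x ->
    `|f (1 + x)| <= 2 * `|x| ^+ 3.
  by move=> cx ->; rewrite normrM [in leRHS]exprSr mulrA ler_wpM2r // dfle.
have [x0|x0] := leP 0 x.
  have [|||c] := @MVT_segment R f df 1 (1 + x).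
  - by rewrite lerDl.
  - by move=> y /andP[/= y1 _]; apply: dfE; move: y1; rewrite bnd_simp; lra.
  - apply: continuous_in_subspaceT => y; rewrite inE /= in_itv /= => /andP[y1 _].
    by apply: f_cont; lra.
  rewrite in_itv /= => /andP[c1 c2]; rewrite f1 subr0 addrAC subrr add0r.
  by apply: main; rewrite !ger0_norm; lra.
have xh : - (1 / 2) <= x by move: x2; rewrite ler_norml; lra.
have [|||c] := @MVT_segment R f df (1 + x) 1.
- by rewrite gerDl ltW.
- by move=> y /andP[/= y1 _]; apply: dfE; move: y1; rewrite bnd_simp; lra.
- apply: continuous_in_subspaceT => y; rewrite inE /= in_itv /= => /andP[y1 _].
  by apply: f_cont; lra.
rewrite in_itv /= => /andP[c1 c2]; rewrite f1 sub0r => fE.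
apply: (main c); first by rewrite !ler0_norm; lra.
by rewrite -[LHS]opprK fE; ring.
Qed.

(** Dividing by [D] leaves ln |1 + g w| = ln (1 + x) / 2 with [x = 2 * w1 + N], w1 = Re (g w), N =
    |g w|^2. To second order this is w1 + N / 2 - w1^2, and N / 2 - w1^2 = - Re ((g w)^2) / 2 is
    harmonic: no multiple of |w|^2 remains. *)
Lemma taylor2_ln_normc_affine (al be : R[i]) z : al + be * z != 0 ->
  taylor2 (fun w => ln (normc (al + be * w))) z 0.
Proof.
set D := al + be * z => D0.
have nD : 0 < normc D.
  by rewrite lt_neqAle normc_ge0 andbT eq_sym; apply: contra D0 => /eqP/Normc.eq0_normc ->.
have affE w : al + be * (z + w) = D * (1 + be / D * w).
  by rewrite [RHS]mulrDr mulr1 mulrA [D * _]mulrC divfK // /D mulrDr addrA.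
case: (be / D) affE => g1 g2 affE.
pose G := g1 ^+ 2 + g2 ^+ 2.
have G0 : 0 <= G by rewrite addr_ge0 // sqr_ge0.
exists g1, (- g2), (- (g1 ^+ 2 - g2 ^+ 2) / 2), (2 * g1 * g2) => k k0.
(* [1 / 6] keeps [|x| <= 3 * dl] below [1 / 2]; 29 = 27 + 1 + 1 collects the cubic remainder,
   [w1 * N] and [N ^+ 2 / 4]. *)
pose dl := Num.min (1 / 6) (k / (29 * (G + 1))).
have dl0 : 0 < dl by rewrite lt_min; apply/andP; split; [lra | apply: divr_gt0 => //; lra].
have dl6 : dl <= 1 / 6 by rewrite ge_min lexx.
have dlk : 29 * dl * G <= k.
  have : dl <= k / (29 * (G + 1)) by rewrite ge_min lexx orbT.
  rewrite ler_pdivlMr; [nra | lra].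
exists (dl / (1 + G)); first by apply: divr_gt0 => //; lra.
move=> u v uv; set n := u ^+ 2 + v ^+ 2 in uv *.
have n0 : 0 <= n by rewrite addr_ge0 // sqr_ge0.
pose w1 := g1 * u - g2 * v; pose w2 := g1 * v + g2 * u; pose N := w1 ^+ 2 + w2 ^+ 2.
have NE : N = G * n by rewrite /N /G /n /w1 /w2; ring.
have Nd : N <= dl ^+ 2.
  rewrite NE; apply: (le_trans (ler_wpM2l G0 uv)).
  rewrite expr_div_n mulrA ler_pdivrMr; last by apply: exprn_gt0; lra.
  have := sqr_ge0 dl; have := sqr_ge0 G; nra.
have N0 : 0 <= N by rewrite NE mulr_ge0.
pose x := 2 * w1 + N.
have w1d : `|w1| <= dl.
  rewrite -(@ler_pXn2r _ 2%N) ?nnegrE ?(ltW dl0) // real_normK ?num_real //.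
  by apply: le_trans Nd; rewrite lerDl sqr_ge0.
have /andP[w1l w1u] : - dl <= w1 <= dl by rewrite -ler_norml.
have dd : dl ^+ 2 <= dl by rewrite expr2 ger_pMl //; lra.
have xd : `|x| <= 3 * dl by rewrite ler_norml /x; lra.
have x2 : `|x| <= 1 / 2 by lra.
have /andP[xl _] : - (1 / 2) <= x <= 1 / 2 by rewrite -ler_norml.
have lnE : ln (normc (al + be * (z + (u +i* v)))) = ln (normc D) + ln (1 + x) / 2.
  rewrite affE Normc.normcM.
  have -> : 1 + (g1 +i* g2) * (u +i* v) = (1 + w1) +i* w2.
    by apply/eqP; rewrite eq_complex /= /w1 /w2 add0r !eqxx.
  have -> : normc ((1 + w1) +i* w2) = (1 + x) `^ 2^-1.
    rewrite powR12_sqrt; last lra.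
    by rewrite normcE; congr Num.sqrt; rewrite /x /N; ring.
  rewrite lnM ?posrE ?powR_gt0 //; last lra.
  by rewrite ln_powR [2^-1 * _]mulrC.
rewrite lnE -/D; have := ln1D_taylor2 x2.
set E := ln (1 + x) - _ => HE.
rewrite (_ : _ - _ = E / 2 - w1 * N - N ^+ 2 / 4); last first.
  by rewrite /E /x /N /n /w1 /w2; field.
have x3 : `|x| ^+ 3 <= 27 * dl * N.
  rewrite exprSr real_normK ?num_real //.
  have x9 : x ^+ 2 <= 9 * N.
    have : w1 ^+ 2 <= N by rewrite lerDl sqr_ge0.
    have : w1 * N <= dl * N by apply: ler_wpM2r.
    have : N ^+ 2 <= dl ^+ 2 * N by rewrite expr2 ler_wpM2r.
    rewrite /x; nra.
  apply: (@le_trans _ _ ((9 * N) * (3 * dl))); last by nra.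
  by apply: ler_pM; rewrite // sqr_ge0.
have w1N : `|w1 * N| <= dl * N by rewrite normrM (ger0_norm N0) ler_wpM2r.
have N2 : `|N ^+ 2 / 4| <= dl * N.
  rewrite ger0_norm ?divr_ge0 ?sqr_ge0 //.
  have : N ^+ 2 <= dl ^+ 2 * N by rewrite expr2 ler_wpM2r.
  have : dl ^+ 2 * N <= dl * N by rewrite ler_wpM2r.
  have : 0 <= dl * N by rewrite mulr_ge0 // ltW.
  lra.
have E2 : `|E / 2| <= `|x| ^+ 3 by rewrite normrM [X in _ * X]gtr0_norm ?invr_gt0 //; lra.
apply: (@le_trans _ _ (29 * dl * N)); last by rewrite NE mulrA ler_wpM2r.
apply: (le_trans (ler_normB _ _)).
have := ler_normB (E / 2) (w1 * N); lra.
Qed.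

End Taylor.

(** * Blaschke logarithms and the maximum principle *)

Section Comparison.
Local Open Scope complex_scope.
Context {R : realType}.
Implicit Types (p z w : R[i]).

(** The logarithm of the modulus of the Blaschke factor. As [ln] is real valued, the pole does not
    get the value -oo; the estimates below keep [z] at a positive distance from [p]. *)
Definition blaschke_ln p z : R := ln (normc (z - p)) - ln (normc (1 - p^* * z)).

Lemma sqr_normc_blaschke p z :
  normc (1 - p^* * z) ^+ 2 =
  normc (z - p) ^+ 2 + (1 - normc p ^+ 2) * (1 - normc z ^+ 2).
Proof.
case: p z => p1 p2 [z1 z2].
have -> : 1 - (p1 +i* p2)^* * (z1 +i* z2) =
    (1 - (p1 * z1 + p2 * z2)) +i* (p2 * z1 - p1 * z2).
  by apply/eqP; rewrite eq_complex /=; apply/andP; split; apply/eqP; ring.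
have -> : (z1 +i* z2) - (p1 +i* p2) = (z1 - p1) +i* (z2 - p2) by [].
rewrite !sqr_normc; ring.
Qed.

Lemma normc_lt1_sqr z : normc z < 1 -> 0 < 1 - normc z ^+ 2.
Proof. by move=> z1; rewrite subr_gt0 expr_lt1 // normc_ge0. Qed.

Lemma blaschke_den_gt0 p z : normc p < 1 -> normc z < 1 -> 0 < normc (1 - p^* * z).
Proof.
move=> p1 z1; rewrite lt_neqAle normc_ge0 andbT eq_sym; apply/eqP => d0.
have := sqr_normc_blaschke p z; rewrite d0 expr0n /=.
have := mulr_gt0 (normc_lt1_sqr p1) (normc_lt1_sqr z1).
have := sqr_ge0 (normc (z - p)); lra.
Qed.

Lemma double_blaschke_ln p z : normc p < 1 -> normc z < 1 -> 0 < normc (z - p) ->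
  2 * blaschke_ln p z =
  - ln (1 + (1 - normc p ^+ 2) * (1 - normc z ^+ 2) / normc (z - p) ^+ 2).
Proof.
move=> p1 z1 zp0; have d0 := blaschke_den_gt0 p1 z1.
have -> : 1 + (1 - normc p ^+ 2) * (1 - normc z ^+ 2) / normc (z - p) ^+ 2 =
    normc (1 - p^* * z) ^+ 2 / normc (z - p) ^+ 2.
  by rewrite sqr_normc_blaschke; field; rewrite gt_eqF.
by rewrite ln_div ?posrE ?exprn_gt0 // !lnXn // /blaschke_ln; lra.
Qed.

(** From [ln (1 + y) <= y]: the logarithm tends to 0 at least linearly at the unit circle, uniformly
    in the pole. *)
Lemma blaschke_ln_ge (eta : R) p z : normc p < 1 -> normc z < 1 -> 0 < eta ->
  eta <= normc (z - p) -> - ((1 - normc z ^+ 2) / eta ^+ 2) <= blaschke_ln p z.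
Proof.
move=> p1 z1 e0 zp; have zp0 : 0 < normc (z - p) by lra.
have P := normc_lt1_sqr p1; have Z := normc_lt1_sqr z1.
have E2 := double_blaschke_ln p1 z1 zp0.
have le : (1 - normc p ^+ 2) * (1 - normc z ^+ 2) / normc (z - p) ^+ 2 <=
    (1 - normc z ^+ 2) / eta ^+ 2.
  apply: ler_pM; rewrite ?mulr_ge0 ?invr_ge0 ?exprn_ge0 ?normc_ge0 ?(ltW P) ?(ltW Z) //.
    by rewrite ler_piMl ?(ltW Z) // gerBl sqr_ge0.
  by rewrite lef_pV2 ?posrE ?exprn_gt0 // lerXn2r ?nnegrE ?normc_ge0 ?(ltW e0).
have T0 : 0 <= (1 - normc p ^+ 2) * (1 - normc z ^+ 2) / normc (z - p) ^+ 2.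
  by rewrite divr_ge0 ?exprn_ge0 ?normc_ge0 // mulr_ge0 ?ltW.
have := @le_ln1Dx R _ (lt_le_trans (ltrN10 R) T0).
have : 0 <= (1 - normc z ^+ 2) / eta ^+ 2 by rewrite divr_ge0 ?exprn_ge0 ?ltW.
lra.
Qed.

Lemma taylor2_blaschke_ln p z : normc p < 1 -> normc z < 1 -> 0 < normc (z - p) ->
  taylor2 (blaschke_ln p) z 0.
Proof.
move=> p1 z1 zp.
have n0 w : 0 < normc w -> w != 0.
  by apply: contraTneq => ->; rewrite Normc.normc0 ltxx.
have T1 : taylor2 (fun w => ln (normc (w - p))) z 0.
  rewrite (_ : (fun _ => _) = (fun w => ln (normc (- p + 1 * w)))); last first.
    by apply/funext => w; rewrite mul1r addrC.
  by apply: taylor2_ln_normc_affine; apply: n0; rewrite mul1r addrC.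
have T2 : taylor2 (fun w => ln (normc (1 - p^* * w))) z 0.
  rewrite (_ : (fun _ => _) = (fun w => ln (normc (1 + - p^* * w)))); last first.
    by apply/funext => w; rewrite mulNr.
  by apply: taylor2_ln_normc_affine; apply: n0; rewrite mulNr; exact: blaschke_den_gt0.
have := taylor2D T1 (taylor2Z (-1) T2); rewrite mulr0 addr0; congr taylor2.
by apply/funext => w; rewrite mulN1r.
Qed.

Lemma closed_cdisc p (r : R) : closed ([set z | normc (z - p) <= r] : set R[i]^o).
Proof.
rewrite -[X in closed X]setCK; apply: open_closedC; rewrite openE => z /= /negP.
rewrite -ltNge => zr; apply/near_normcP; exists (normc (z - p) - r); first by rewrite subr_gt0.
move=> w wz; apply/negP; rewrite -ltNge.
by have := normc_triangle w z p; rewrite [normc (z - w)]normc_distC; lra.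
Qed.

Lemma closed_setC_disc p (r : R) : closed ([set z | r <= normc (z - p)] : set R[i]^o).
Proof.
rewrite -[X in closed X]setCK; apply: open_closedC; rewrite openE => z /= /negP.
rewrite -ltNge => zr; apply/near_normcP; exists (r - normc (z - p)); first by rewrite subr_gt0.
move=> w wz; apply/negP; rewrite -ltNge.
by have := normc_triangle z w p; lra.
Qed.

Lemma compact_cdisc0 (r : R) : compact ([set z | normc z <= r] : set R[i]^o).
Proof.
pose phi (x : R * R) : R[i]^o := x.1 +i* x.2.
have cphi : continuous phi.
  move=> x A /near_normcP[e e0 eA].
  exists (ball x.1 (e / 2), ball x.2 (e / 2)).
    by split; apply: nbhsx_ballx; rewrite divr_gt0.
  move=> y [/=]; rewrite -!ball_normE /= => y1 y2; apply: eA.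
  have -> : phi y - phi x = (y.1 - x.1) +i* (y.2 - x.2) by [].
  apply: (le_lt_trans (normc_le_abs _ _)).
  by rewrite [e]splitr ltrD // distrC.
have cK : compact (phi @` (`[- r, r] `*` `[- r, r])).
  apply: continuous_compact; first exact: continuous_subspaceT.
  by apply: compact_setX; exact: segment_compact.
apply: (subclosed_compact _ cK).
  rewrite (_ : [set _ | _] = [set z | normc (z - 0) <= r]); first exact: closed_cdisc.
  by apply/funext => z; rewrite /= subr0.
move=> [a b] ab; have r0 : 0 <= r := le_trans (normc_ge0 _) ab.
have sq : a ^+ 2 + b ^+ 2 <= r ^+ 2.
  by rewrite -sqr_normc lerXn2r ?nnegrE // normc_ge0.
exists (a, b) => //; split; rewrite /= in_itv /= -ler_norml.
  rewrite -(@ler_pXn2r _ 2%N) ?nnegrE // real_normK ?num_real //.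
  by apply: le_trans sq; rewrite lerDl sqr_ge0.
rewrite -(@ler_pXn2r _ 2%N) ?nnegrE // real_normK ?num_real //.
by apply: le_trans sq; rewrite lerDr sqr_ge0.
Qed.

Lemma subharmonic_le_blaschke (f : R[i] -> \bar R) n (p : 'I_n -> R[i])
    (m : 'I_n -> R) (eta M : R) :
  let g z := M + \sum_i m i * blaschke_ln (p i) z in
  subharmonic_on (disc 0 1) f -> (forall z, normc z < 1 -> (f z <= M%:E)%E) ->
  (forall i, normc (p i) < 1) -> (forall i, 0 <= m i) -> 0 < eta ->
  (forall z, normc z < 1 -> (forall i, eta <= normc (z - p i)) ->
     (exists i, normc (z - p i) = eta) -> (f z <= (g z)%:E)%E) ->
  forall z, normc z < 1 -> (forall i, eta <= normc (z - p i)) -> (f z <= (g z)%:E)%E.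
Proof.
move=> g sf fM p1 m0 eta0 bdry z0 z01 z0p; rewrite leNgt; apply/negP => gf.
have [flt usc _] := sf.
have D1 z : normc z < 1 -> disc 0 1 z by rewrite /disc /= subr0.
have f0fin : f z0 \is a fin_num.
  by rewrite fin_numElt (lt_trans _ gf) ?ltNyr //=; exact/flt/D1.
pose beta := fine (f z0) - g z0.
have beta0 : 0 < beta by rewrite subr_gt0 -lte_fin fineK.
(* One half of [beta] pays for the penalty, which is at most [k], the other for the amount by which
   [g] may fall below [M] near the unit circle. *)
pose k := beta / 2; have k0 : 0 < k by rewrite divr_gt0.
have bk : beta = k + k by rewrite /k; field.
pose G z := g z - k * normc z ^+ 2.
pose Sm := \sum_i m i; have Sm0 : 0 <= Sm by apply: sumr_ge0.
have g_ge z : normc z < 1 -> (forall i, eta <= normc (z - p i)) ->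
    M - Sm * ((1 - normc z ^+ 2) / eta ^+ 2) <= g z.
  move=> z1 zp; rewrite lerD2l mulr_suml -sumrN; apply: ler_sum => i _.
  by rewrite -mulrN ler_wpM2l // blaschke_ln_ge.
pose tau := Num.min (1 / 2) (k * eta ^+ 2 / (2 * (Sm + 1))).
have tau0 : 0 < tau.
  rewrite lt_min; apply/andP; split; first lra.
  by rewrite divr_gt0 ?mulr_gt0 ?exprn_gt0 //; lra.
have tau2 : tau <= 1 / 2 by rewrite ge_min lexx.
have tauS : Sm * (tau / eta ^+ 2) < k.
  have : tau <= k * eta ^+ 2 / (2 * (Sm + 1)) by rewrite ge_min lexx orbT.
  rewrite [Sm * _]mulrA ltr_pdivrMr ?exprn_gt0 // ler_pdivlMr; last lra.
  have := mulr_gt0 k0 (exprn_gt0 2 eta0); nra.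
(* The penalty [k |z|^2] and the decay of the Blaschke logarithms keep
   [f - G] below [beta] near the unit circle, so its maximum is interior. *)
have near_bd z : normc z < 1 -> (forall i, eta <= normc (z - p i)) ->
    1 - tau <= normc z ^+ 2 -> (f z - (G z)%:E < beta%:E)%E.
  move=> z1 zp zt; rewrite lteBlDr //; apply: (le_lt_trans (fM _ z1)).
  rewrite -EFinD lte_fin /G; have := g_ge _ z1 zp; have Z := normc_lt1_sqr z1.
  have : Sm * ((1 - normc z ^+ 2) / eta ^+ 2) <= Sm * (tau / eta ^+ 2).
    rewrite ler_wpM2l // ler_wpM2r ?invr_ge0 ?exprn_ge0 ?(ltW eta0) //; lra.
  have : k * normc z ^+ 2 <= k by rewrite ger_pMr //; lra.
  rewrite bk; lra.
have taylorG z : normc z < 1 -> (forall i, eta <= normc (z - p i)) -> taylor2 G z (- k).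
  move=> z1 zp.
  have T1 : taylor2 (fun w => \sum_i m i * blaschke_ln (p i) w) z 0.
    apply: taylor2_sum => i; apply: taylor2_blaschke_ln => //.
    exact: lt_le_trans (zp i).
  have := taylor2D (taylor2D (taylor2_cst M z) T1) (taylor2Z (- k) (taylor2_sqr_normc z)).
  rewrite !add0r mulr1; congr taylor2.
  by apply/funext => w; rewrite /G /g mulNr.
pose r1 := Num.sqrt (1 - tau).
have r1E : r1 ^+ 2 = 1 - tau by rewrite sqr_sqrtr //; lra.
have r10 : 0 <= r1 by exact: sqrtr_ge0.
have r1lt : r1 < 1 by rewrite -(@ltr_pXn2r _ 2%N) ?nnegrE // expr1n r1E; lra.
have r1P z : r1 <= normc z -> 1 - tau <= normc z ^+ 2.
  by move=> zr; rewrite -r1E lerXn2r ?nnegrE ?normc_ge0.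
pose K : set R[i]^o := [set z | normc z <= r1 /\ forall i, eta <= normc (z - p i)].
have K1 z : K z -> normc z < 1 by move=> [zr _]; exact: le_lt_trans r1lt.
have cK : compact K.
  have cD := @compact_cdisc0 1; apply: (subclosed_compact _ cD) => [|z /K1 /ltW //].
  have -> : K = [set z : R[i]^o | normc (z - 0) <= r1] `&`
      \bigcap_(i in [set: 'I_n]) [set z : R[i]^o | eta <= normc (z - p i)].
    apply/seteqP; split=> z /=; rewrite subr0 => -[zr zp]; split=> // i.
      by move=> _; exact: zp.
    exact: (zp i I).
  apply: closedI; first exact: closed_cdisc.
  by apply: closed_bigI => i _; exact: closed_setC_disc.
have ub0 : (beta%:E <= f z0 - (G z0)%:E)%E.
  rewrite -(fineK f0fin) -EFinB lee_fin /G /beta.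
  by have := mulr_ge0 (ltW k0) (sqr_ge0 (normc z0)); lra.
have K0 : K z0.
  split=> //; rewrite leNgt; apply/negP => /ltW/r1P zt.
  by have := near_bd z0 z01 z0p zt; rewrite ltNge ub0.
have uK z : K z -> (f z - (G z)%:E <= (Sm / eta ^+ 2 + k)%:E)%E.
  move=> Kz; have z1 := K1 _ Kz; have zp := Kz.2.
  rewrite leeBlDr //; apply: (le_trans (fM _ z1)).
  rewrite -EFinD lee_fin /G; have := g_ge _ z1 zp; have Z := normc_lt1_sqr z1.
  have : Sm * ((1 - normc z ^+ 2) / eta ^+ 2) <= Sm / eta ^+ 2.
    rewrite ler_wpM2l // ler_piMl ?invr_ge0 ?exprn_ge0 ?(ltW eta0) //.
    by rewrite gerBl sqr_ge0.
  have : k * normc z ^+ 2 <= k by rewrite ger_pMr //; lra.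
  lra.
have uscK (z : R[i]^o) (b : R) : K z -> (f z - (G z)%:E < b%:E)%E ->
    \forall w \near z, K w -> (f w - (G w)%:E < b%:E)%E.
  move=> Kz; rewrite lteBlDr // -EFinD => fz.
  have [dl dl0 fzd] : exists2 dl : R, 0 < dl & (f z < (b + G z - dl)%:E)%E.
    case: (f z) fz => [v||] //; rewrite ?lte_fin => vz.
      by exists ((b + G z - v) / 2); rewrite ?lte_fin; lra.
    by exists 1; rewrite ?ltNyr.
  have [e1 e10 P1] := (near_normcP _ _).1 (usc _ _ (D1 _ (K1 _ Kz)) fzd).
  have [e2 e20 P2] := taylor2_continuous (taylorG _ (K1 _ Kz) Kz.2) dl0.
  apply/near_normcP; exists (Num.min e1 e2); first by rewrite lt_min e10.
  move=> w; rewrite lt_min => /andP[/P1 fw /P2 Gw] _.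
  rewrite lteBlDr // -EFinD; apply: (lt_le_trans fw); rewrite lee_fin.
  by move: Gw; rewrite ltr_norml; lra.
have [z1 Kz1 z1max] := @usc_attains_max R R[i]^o K (fun z => f z - (G z)%:E)%E
  beta (Sm / eta ^+ 2 + k) z0 cK K0 ub0 uK uscK.
have [z1r z1p] := Kz1; have z11 := K1 _ Kz1.
have u1 := le_trans ub0 (z1max _ K0).
have {}z1r : normc z1 < r1.
  rewrite ltNge; apply/negP => /r1P zt.
  by have := near_bd z1 z11 z1p zt; rewrite ltNge u1.
move: (u1); rewrite leeBrDr // -EFinD => f1ge.
have f1fin : f z1 \is a fin_num.
  by rewrite fin_numElt (lt_le_trans _ f1ge) ?ltNyr //=; exact/flt/D1.
(* On a small circle [f <= g] would give f - G <= k |z|^2 < beta. *)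
have {}z1p i : eta < normc (z1 - p i).
  rewrite lt_neqAle z1p andbT; apply/eqP => zE.
  have := bdry z1 z11 z1p (ex_intro _ i (esym zE)); apply/negP; rewrite -ltNge.
  apply: lt_le_trans f1ge; rewrite lte_fin /G bk.
  have : k * normc z1 ^+ 2 <= k by rewrite ger_pMr //; have := normc_lt1_sqr z11; lra.
  lra.
have [e e0 eK] : exists2 e : R, 0 < e & forall w, normc (w - z1) < e -> K w.
  apply/near_normcP.
  have N1 : \forall w \near (z1 : R[i]^o), normc w <= r1.
    apply/near_normcP; exists (r1 - normc z1); first by rewrite subr_gt0.
    by move=> w wz; have := normc_triangle z1 w 0; rewrite !subr0; lra.
  have N2 : \forall w \near (z1 : R[i]^o), forall i, eta <= normc (w - p i).
    apply: (@filter_forall R[i]^o 'I_n (fun i w => eta <= normc (w - p i))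
      (nbhs (z1 : R[i]^o)) (nbhs_filter (z1 : R[i]^o))) => i.
    apply/near_normcP.
    exists (normc (z1 - p i) - eta); first by rewrite subr_gt0.
    move=> w wz; have := normc_triangle w z1 (p i).
    by rewrite [normc (z1 - w)]normc_distC; lra.
  by apply: filterS (filterI N1 N2) => w [w1 w2].
(* The non-harmonic part of [G] is - k |w|^2; an expansion error of (k / 2) |w|^2 leaves the
   negative term that touching requires. *)
have [a [b [c [q HG]]]] := taylorG z1 z11 (fun i => ltW (z1p i)).
have [r2 r20 {}HG] := HG _ (divr_gt0 k0 (ltr0Sn R 1)).
pose rho := Num.min (e / 2) r2.
have rho0 : 0 < rho by rewrite lt_min r20 divr_gt0.
have rhoe : rho < e by rewrite gt_min; apply/orP; left; lra.
have rho2 : rho <= r2 by rewrite ge_min lexx orbT.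
apply: (@subharmonic_touch _ _ f z1 (fine (f z1)) a b c q (k / 2) rho sf) => //.
- by rewrite divr_gt0.
- by move=> w wz; apply/D1/K1/eK; exact: le_lt_trans rhoe.
- by rewrite fineK.
move=> u v uv.
have Kw : K (z1 + (u +i* v)).
  apply: eK; rewrite addrC addKr; apply: le_lt_trans rhoe.
  by rewrite -(@ler_pXn2r _ 2%N) ?nnegrE ?normc_ge0 ?(ltW rho0) // sqr_normc.
have := z1max _ Kw; rewrite leeBlDr // -(fineK f1fin) -EFinB -EFinD => /le_trans; apply.
have uv2 : u ^+ 2 + v ^+ 2 <= r2 ^+ 2.
  by apply: (le_trans uv); rewrite lerXn2r ?nnegrE ?(ltW rho0) ?(ltW r20).
have := HG _ _ uv2; rewrite ler_norml lee_fin => /andP[_].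
set N := u ^+ 2 + v ^+ 2; set X := G (z1 + _); lra.
Qed.
End Comparison.

(** * Doubling and capacity estimates *)

Section Estimates.
Local Open Scope complex_scope.
Context {R : realType}.
Implicit Types (p x z w : R[i]) (f : R[i] -> \bar R).

Lemma disc_sub_radius x (s rho : R) : 0 < s -> disc x s `<=` disc 0 rho ->
  normc x < rho /\ s < 4 * rho.
Proof.
move=> s0 sub; have xr : normc x < rho.
  by have := sub x; rewrite /disc /= !subr0 subrr Normc.normc0 => ->.
split=> //; have h0 : 0 <= s / 2 by lra.
have n2 : normc ((s / 2)%:C) = s / 2 by rewrite normcE expr0n addr0 sqrtr_sqr ger0_norm.
have : disc 0 rho (x + (s / 2)%:C).
  by apply: sub; rewrite /disc /= addrC addKr n2; lra.
rewrite /disc /= subr0 => X; have := normc_triangle 0 (x + (s / 2)%:C) x.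
by rewrite subr0 sub0r normcN [X in normc X <= _]addrC addKr n2; lra.
Qed.

Lemma subharmonic_affine f x (T : R) : 0 < T -> disc x T `<=` disc 0 1 ->
  subharmonic_on (disc 0 1) f ->
  subharmonic_on (disc 0 1) (fun z => f (x + T%:C * z)).
Proof.
move=> T0 sub [flt usc mean].
have nT z : normc (T%:C * z) = T * normc z.
  by rewrite Normc.normcM normcE expr0n addr0 sqrtr_sqr gtr0_norm.
have D1 z : disc 0 1 z -> disc 0 1 (x + T%:C * z).
  rewrite /disc /= subr0 => z1; apply: sub; rewrite /disc /= addrC addKr nT.
  by rewrite -[ltRHS]mulr1 ltr_pM2l.
split=> [z /D1/flt//|z b Uz fz|z rho rho0 zU].
  have [e e0 eP] := (near_normcP _ _).1 (usc _ _ (D1 _ Uz) fz).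
  apply/near_normcP; exists (e / T) => [|w wz]; first exact: divr_gt0.
  apply: eP; rewrite opprD addrACA subrr add0r -mulrBr nT mulrC.
  by rewrite -ltr_pdivlMr.
have cT : T%:C != 0 by rewrite eq_complex /= gt_eqF.
have zU' : cdisc (x + T%:C * z) (T * rho) `<=` disc 0 1.
  move=> w wz; rewrite (_ : w = x + T%:C * ((w - x) / T%:C)); last first.
    by rewrite mulrC divfK // addrC subrK.
  apply/D1/zU; rewrite /cdisc /= -(ler_pM2l T0) -nT mulrBr [T%:C * _]mulrC divfK //.
  by move: wz; rewrite /cdisc /= opprD addrA.
apply: (le_trans (mean _ _ (mulr_gt0 T0 rho0) zU')).
rewrite le_eqVlt; apply/orP; left; apply/eqP; congr (_ * _)%E.
apply: eq_integral => theta _; congr f.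
by rewrite /circle_point mulrDr rmorphM !mulrA !addrA.
Qed.

Lemma compact_usc_uniform f (K : set R[i]) (b : R) : compact (K : set R[i]^o) ->
  (forall p, K p -> \forall w \near (p : R[i]^o), (f w < b%:E)%E) ->
  exists2 e : R, 0 < e & forall p w, K p -> normc (w - p) < e -> (f w < b%:E)%E.
Proof.
move=> /compact_near_coveringP Kc fb.
have H := Kc R (0^'+) (fun (e : R) (p : R[i]^o) =>
  forall w, normc (w - p) < e -> (f w < b%:E)%E) _.
have {}H : \forall e \near (0 : R)^'+, K `<=` (fun p =>
    forall w, normc (w - p) < e -> (f w < b%:E)%E).
  apply: H => p Kp; have [e e0 eP] := (near_normcP _ _).1 (fb _ Kp).
  exists ([set q | normc (q - p) < e / 2], [set i | i < e / 2]).
    split=> /=; first by apply/near_normcP; exists (e / 2); rewrite ?divr_gt0.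
    by apply: nbhs_right_lt; rewrite divr_gt0.
  move=> [q i] /= [qp ie] w wq; apply: eP.
  by have := normc_triangle q w p; lra.
have [e [e0 eP]] : exists e : R, 0 < e /\ K `<=` (fun p =>
    forall w, normc (w - p) < e -> (f w < b%:E)%E).
  near (0 : R)^'+ => e; exists e; split; near: e; last exact: H.
  exact: nbhs_right_gt.
by exists e => // p w /eP; apply.
Unshelve. all: by end_near. Qed.

Lemma normcJ p : normc p^* = normc p.
Proof. by case: p => a b; rewrite !normcE sqrrN. Qed.

Lemma blaschke_den_le2 p z : normc p < 1 -> normc z < 1 -> normc (1 - p^* * z) <= 2.
Proof.
move=> p1 z1; have := normc_triangle 0 1 (p^* * z).
rewrite subr0 sub0r normcN Normc.normc1 Normc.normcM normcJ.
have := normc_ge0 p; have := normc_ge0 z; nra.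
Qed.

Lemma blaschke_den_ge (r : R) p z : normc p < r -> normc z < 1 ->
  1 - r <= normc (1 - p^* * z).
Proof.
move=> pr z1; have := normc_triangle (p^* * z) 1 0.
rewrite !subr0 Normc.normc1 Normc.normcM normcJ.
have := normc_ge0 p; have := normc_ge0 z; nra.
Qed.

(** 1 - |B_p(z)|^2 = (1 - |p|^2)(1 - |z|^2) / |1 - conj(p) z|^2 is at least (1 - r^2)^2 / 4 for |p|,
    |z| < r, the denominator being at most 4; [ln (1 - y) <= - y] and the square root give 8. *)
Definition blaschke_gap (r : R) : R := (1 - r ^+ 2) ^+ 2 / 8.

Lemma blaschke_gap_gt0 r : 0 < r -> r < 1 -> 0 < blaschke_gap r.
Proof. by move=> r0 r1; rewrite divr_gt0 // exprn_gt0 // subr_gt0 expr_lt1 // ltW. Qed.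

Lemma blaschke_ln_le (r : R) p z : 0 < r -> r < 1 -> normc p < r -> normc z < r ->
  0 < normc (z - p) -> blaschke_ln p z <= - blaschke_gap r.
Proof.
move=> r0 r1 pr zr zp; have p1 := lt_trans pr r1; have z1 := lt_trans zr r1.
have d0 := blaschke_den_gt0 p1 z1.
have d2 := blaschke_den_le2 p1 z1.
have := sqr_normc_blaschke p z; set D := normc (1 - _) in d0 d2 *; set N := normc (z - p).
set q := (1 - normc p ^+ 2) * _ => DE.
have D4 : D ^+ 2 <= 4 by nra.
have D20 : 0 < D ^+ 2 by rewrite exprn_gt0.
have qr : (1 - r ^+ 2) ^+ 2 <= q.
  have sq (w : R[i]) : normc w < r -> 1 - r ^+ 2 <= 1 - normc w ^+ 2.
    by move=> wr; rewrite lerB // lerXn2r ?nnegrE ?normc_ge0 ?(ltW r0) ?(ltW wr).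
  by rewrite expr2 /q; apply: ler_pM; rewrite ?sq // subr_ge0 expr_le1 // ltW.
have N20 : 0 < N ^+ 2 by rewrite exprn_gt0.
have Y1 : q / D ^+ 2 < 1 by rewrite ltr_pdivrMr // mul1r DE; lra.
have qD : (1 - r ^+ 2) ^+ 2 / 4 <= q / D ^+ 2.
  have r20 := sqr_ge0 (1 - r ^+ 2).
  by apply: ler_pM; rewrite ?invr_ge0 // lef_pV2 ?posrE.
have := @le_ln1Dx R (- (q / D ^+ 2)).
rewrite ltrN2 => /(_ Y1).
have -> : 1 + - (q / D ^+ 2) = N ^+ 2 / D ^+ 2.
  by apply: (mulIf (lt0r_neq0 D20)); rewrite mulrDl mulNr !divfK ?gt_eqF // mul1r DE; ring.
rewrite ln_div ?posrE // !lnXn // /blaschke_ln /blaschke_gap -/D -/N; lra.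
Qed.

(** The logarithm bounds the growth of ln |B_x| from the lower bound ln (t / 4) on |z - x| = t / 2
    up to |z - x| < t / r; the gap converts [M1 - M2] into a bound for the multiple of ln |B_x| in
    use. The summand 1 covers the cases with [M2 <= S], where f <= M1 <= S + (M1 - M2). *)
Definition doubling_const (r : R) : R := 1 + ln (4 / (r * (1 - r))) / blaschke_gap r.

Lemma doubling_const_ge1 (r : R) : 0 < r -> r < 1 ->
  0 <= ln (4 / (r * (1 - r))) /\ 1 <= doubling_const r.
Proof.
move=> r0 r1; have l0 : 0 <= ln (4 / (r * (1 - r))).
  have rr : 0 < r * (1 - r) by rewrite mulr_gt0 // subr_gt0.
  by apply: ln_ge0; rewrite ler_pdivlMr //; nra.
by split=> //; rewrite lerDl divr_ge0 // ltW // blaschke_gap_gt0.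
Qed.

Lemma subharmonic_doubling (r : R) f x (t S M1 M2 : R) z0 : 0 < r -> r < 1 -> 0 < t ->
  disc x (t / r) `<=` disc 0 r -> subharmonic_on (disc 0 1) f ->
  (forall z, normc z < 1 -> (f z <= M1%:E)%E) ->
  normc z0 < r -> (M2%:E <= f z0)%E ->
  (forall z, disc x t z -> (f z <= S%:E)%E) ->
  forall z, disc x (t / r) z -> (f z <= (S + (M1 - M2) * doubling_const r)%:E)%E.
Proof.
move=> r0 r1 t0 sub sf fM z0r Mz0 fS z xz.
have [l0 c1] := doubling_const_ge1 r0 r1.
have k0 := blaschke_gap_gt0 r0 r1.
have zr : normc z < r by have := sub _ xz; rewrite /disc /= subr0.
have z1 := lt_trans zr r1; have z01 := lt_trans z0r r1.
have M21 : M2 <= M1 by rewrite -lee_fin (le_trans Mz0) // fM.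
have Mc : M1 - M2 <= (M1 - M2) * doubling_const r.
  by rewrite ler_peMr // subr_ge0.
have [xr tr] := disc_sub_radius (divr_gt0 t0 r0) sub.
have t4 : t < 4 by move: tr; rewrite ltr_pdivrMr //; nra.
have [MS|SM] := leP M1 S.
  by apply: (le_trans (fM _ z1)); rewrite lee_fin; lra.
(* [sg] makes M1 + sg ln |B_x| at least [S] on |z - x| = t / 2, where |B_x| >= t / 4. That circle
   lies inside the open disc on which [S] bounds [f]. *)
pose ell := - ln (t / 4).
have ell0 : 0 < ell.
  by rewrite oppr_gt0 ln_lt0 // divr_gt0 //= ltr_pdivrMr // mul1r.
pose sg := (M1 - S) / ell; have sg0 : 0 < sg by rewrite divr_gt0 // subr_gt0.
have SE : S = M1 - sg * ell by rewrite /sg divfK ?gt_eqF //; lra.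
have t20 : 0 < t / 2 by lra.
have comp w : normc w < 1 -> t / 2 <= normc (w - x) ->
    (f w <= (M1 + sg * blaschke_ln x w)%:E)%E.
  move=> w1 wt; have x1 := lt_trans xr r1.
  have /= H := @subharmonic_le_blaschke R f 1 (fun=> x) (fun=> sg) (t / 2) M1 sf fM
    (fun=> x1) (fun=> ltW sg0) t20.
  suff /H /(_ w w1 (fun=> wt)) : forall v, normc v < 1 ->
      (forall i : 'I_1, t / 2 <= normc (v - x)) ->
      (exists i : 'I_1, normc (v - x) = t / 2) ->
      (f v <= (M1 + \sum_(i < 1) sg * blaschke_ln x v)%:E)%E by rewrite big_ord1.
  move=> v v1 _ [_ vt]; rewrite big_ord1; apply: (le_trans (fS v _)).
    by rewrite /disc /= vt; lra.
  rewrite lee_fin SE lerD2l -mulrN ler_wpM2l ?(ltW sg0) // /ell opprK.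
  rewrite /blaschke_ln vt.
  have := blaschke_den_gt0 x1 v1; have := blaschke_den_le2 x1 v1.
  set D := normc _ => D2 D0; have : ln D <= ln 2 by rewrite ler_ln ?posrE.
  have -> : t / 4 = t / 2 / 2 by field.
  by rewrite [ln (t / 2 / 2)]ln_div ?posrE //; lra.
have [z0t|tz0] := ltP (normc (z0 - x)) t.
  have : M2 <= S by rewrite -lee_fin (le_trans Mz0) // fS.
  by move=> MS; apply: (le_trans (fM _ z1)); rewrite lee_fin; lra.
(* The value at [z0], where [f] is at least [M2], limits [sg]. *)
have sgk : sg * blaschke_gap r <= M1 - M2.
  have zx0 : 0 < normc (z0 - x) by lra.
  have := blaschke_ln_le r0 r1 xr z0r zx0.
  have : M2 <= M1 + sg * blaschke_ln x z0.
    by rewrite -lee_fin (le_trans Mz0) // comp //; lra.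
  by nra.
have [zt|tz] := ltP (normc (z - x)) t.
  apply: (le_trans (fS _ zt)); rewrite lee_fin lerDl mulr_ge0 ?subr_ge0 //; lra.
apply: (le_trans (comp z z1 _)); first lra.
have bl : blaschke_ln x z <= ln (t / r) - ln (1 - r).
  rewrite /blaschke_ln; have rr : 0 < 1 - r by lra.
  have d := blaschke_den_ge xr z1; have d0 := lt_le_trans rr d.
  have zx0 : 0 < normc (z - x) by lra.
  have : ln (normc (z - x)) <= ln (t / r) by rewrite ler_ln ?posrE ?divr_gt0 // ltW.
  have : ln (1 - r) <= ln (normc (1 - x^* * z)) by rewrite ler_ln ?posrE.
  lra.
have lE : ln (4 / (r * (1 - r))) = ell + ln (t / r) - ln (1 - r).
  have rr : 0 < 1 - r by lra.
  by rewrite /ell !ln_div ?lnM ?posrE ?mulr_gt0 //; lra.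
rewrite lee_fin [X in X + _](_ : M1 = S + sg * ell); last by rewrite SE; ring.
rewrite -addrA lerD2l.
apply: (@le_trans _ _ (sg * ln (4 / (r * (1 - r))))).
  by rewrite lE -mulrDr ler_wpM2l ?(ltW sg0) //; lra.
apply: (@le_trans _ _ ((M1 - M2) / blaschke_gap r * ln (4 / (r * (1 - r))))).
  by rewrite ler_wpM2r // ler_pdivlMr.
by rewrite mulrAC -mulrA ler_wpM2l ?subr_ge0 // lerDr.
Qed.

(** 2 = 6/5 * 5/4 * 4/3, and each factor is close enough to 1 for 1 - 1/x <= ln x <= x - 1. *)
Lemma ln2_bounds : 6 / 10 <= ln (2 : R) <= 8 / 10.
Proof.
have E : ln 2 = ln (6 / 5) + ln (5 / 4) + ln (4 / 3) :> R.
  rewrite -lnM ?posrE ?divr_gt0 // -lnM ?posrE ?mulr_gt0 ?divr_gt0 //.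
  by congr ln; field.
have up (x : R) : 0 < x -> ln x <= x - 1.
  by move=> x0; have := @le_ln1Dx R (x - 1); rewrite addrCA subrr addr0; apply; lra.
have lo (x : R) : 0 < x -> 1 - x^-1 <= ln x.
  by move=> x0; have := up x^-1; rewrite invr_gt0 lnV ?posrE // => /(_ x0); lra.
have p1 : 0 < 6 / 5 :> R by lra. have p2 : 0 < 5 / 4 :> R by lra. have p3 : 0 < 4 / 3 :> R by lra.
have := up _ p1; have := up _ p2; have := up _ p3.
have := lo _ p1; have := lo _ p2; have := lo _ p3; rewrite !invf_div E; lra.
Qed.

(** Converts the potential bound into the logarithm of the theorem, uniformly in [d]. After
    multiplication by [d] the difference increases with [Y], so the lower bound for [Y] may be
    inserted; the tangent bound for [ln d] then cancels [ln 3] and leaves 40 - 43 ln 2 plus a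
    nonnegative multiple of [d]. *)
Lemma log_constant_bound (d Y lr : R) : 0 < d -> 0 <= lr -> - ln 3 - d * ln 2 <= Y ->
  0 < (ln 24 + Y) / d + ln 28 + lr <= 40 * (ln 4 + 1 + lr + (Y - ln d) / d).
Proof.
move=> d0 lr0 Yge; have /andP[l2 u2] := ln2_bounds.
have l4 : ln 4 = 2 * ln 2 :> R by rewrite mulr_natl -lnXn //; congr ln; ring.
have l24 : ln 24 = 3 * ln 2 + ln 3 :> R.
  by rewrite mulr_natl -lnXn // -lnM ?posrE ?exprn_gt0 //; congr ln; ring.
have l28 : 4 * ln 2 <= ln (28 : R) <= 5 * ln 2.
  by rewrite !mulr_natl -!lnXn // !ler_ln ?posrE ?exprn_gt0 //; lra.
(* the tangent of [ln] at [2 / 3] *)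
have ld : ln d + ln 3 - ln 2 <= 3 * d / 2 - 1.
  have := @le_ln1Dx R (3 * d / 2 - 1); rewrite addrCA subrr addr0 => H.
  have -> : ln d + ln 3 - ln 2 = ln (3 * d / 2).
    by rewrite ln_div ?lnM ?posrE ?mulr_gt0 //; lra.
  by apply: H; have := divr_gt0 (mulr_gt0 (ltr0Sn R 2) d0) (ltr0Sn R 1); lra.
case/andP: l28 => l28 u28.
apply/andP; split.
  have -> : (ln 24 + Y) / d + ln 28 + lr = (ln 24 + Y + d * (ln 28 + lr)) / d.
    by field; rewrite gt_eqF.
  by rewrite divr_gt0 // l24; nra.
rewrite -subr_ge0.
have -> : 40 * (ln 4 + 1 + lr + (Y - ln d) / d) - ((ln 24 + Y) / d + ln 28 + lr) =
   (40 * (d * (ln 4 + 1 + lr) + Y - ln d) - (ln 24 + Y) - d * (ln 28 + lr)) / d.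
  by field; rewrite gt_eqF.
by rewrite divr_ge0 ?(ltW d0) // l24 l4; nra.
Qed.

End Estimates.

(** * The estimate from finitely many poles *)

Section Capacity.
Local Open Scope complex_scope.
Context {R : realType}.

Lemma subharmonic_remez (r d a eps t b M1 M2 : R) (x z0 : R[i]) (omega : set R[i])
    (f : R[i] -> \bar R) :
  let L := (ln 24 + ln (a * t `^ d / eps)) / d + ln 28 + ln r^-1 in
  0 < r -> r < 1 -> 0 < d -> 0 < a -> 0 < eps -> 0 < t -> 0 < L ->
  disc x (t / r) `<=` disc 0 r -> omega `<=` disc x t -> class_A d a omega ->
  (eps%:E <= hausdorff_measure d omega)%E ->
  subharmonic_on (disc 0 1) f -> (forall z, normc z < 1 -> (f z <= M1%:E)%E) ->
  normc z0 < r -> (M2%:E <= f z0)%E ->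
  (forall p, omega p -> (f p <= b%:E)%E) ->
  forall z, disc x t z ->
  (f z <= (b + (M1 - M2) * doubling_const r / blaschke_gap r * L)%:E)%E.
Proof.
move=> L r0 r1 d0 a0 e0 t0 L0 sub ot oA He sf fM z0r Mz0 fb z xz.
have k0 := blaschke_gap_gt0 r0 r1; have [_ c1] := doubling_const_ge1 r0 r1.
have M21 : M2 <= M1 by rewrite -lee_fin (le_trans Mz0) // fM // (lt_trans z0r).
set C := (M1 - M2) * doubling_const r.
have C0 : 0 <= C by rewrite mulr_ge0 ?subr_ge0 //; lra.
pose T := t / r; have T0 : 0 < T by rewrite divr_gt0.
have tT : t < T by rewrite ltr_pdivlMr // gtr_pMr.
have xT w : disc x t w -> disc x T w by move=> wt; exact: lt_trans tT.
have rD w : disc x T w -> normc w < r by move=> /sub; rewrite /disc /= subr0.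
have tD w : disc x t w -> normc w < 1 by move=> /xT/rD/lt_trans; apply.
pose S0 := ereal_sup (f @` disc x t).
have fS0 w : disc x t w -> (f w <= S0)%E by move=> wt; apply: ereal_sup_ubound; exists w.
have S0M : (S0 <= M1%:E)%E by apply: ge_ereal_sup => _ [w /tD w1 <-]; exact: fM.
(* The argument subtracts [S0] from itself, so the value -oo is set aside. *)
have [S0y|S0N] := eqVneq S0 -oo%E.
  by apply: (le_trans (fS0 _ xz)); rewrite S0y leNye.
have S0fin : S0 \is a fin_num.
  by rewrite fin_numE S0N /= -ltey (le_lt_trans S0M) // ltry.
pose S := fine S0; have SE : S0 = S%:E by rewrite /S fineK.
have fS w : disc x t w -> (f w <= S%:E)%E by rewrite -SE; exact: fS0.
apply: (le_trans (fS _ xz)); apply/lee_addgt0Pr => dl dl0; rewrite -EFinD lee_fin.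
set b' := b + dl; rewrite addrAC -/b' leNgt; apply/negP => bS.
have CL0 : 0 <= C / blaschke_gap r * L := mulr_ge0 (divr_ge0 C0 (ltW k0)) (ltW L0).
have b'S : b' < S by lra.
have fS' := subharmonic_doubling r0 r1 t0 sub sf fM z0r Mz0 fS.
have [flt usc _] := sf.
have [eta0 eta00 fnear] : exists2 e : R, 0 < e &
    forall p w, omega p -> normc (w - p) < e -> (f w < b'%:E)%E.
  apply: compact_usc_uniform oA.1 _ => p op; apply: usc.
    by rewrite /disc /= subr0; exact/tD/ot.
  by apply: (le_lt_trans (fb _ op)); rewrite lte_fin /b'; lra.
(* Half of [eta0], so that the boundary circles of radius [eta] lie strictly inside the
   neighbourhood where [f < b']. *)
have eta02 : 0 < eta0 / 2 by lra.
have [n [p [m [eta [op /andP[e1 e2] m0 msum pot]]]]] :=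
  discrete_frostman d0 a0 e0 t0 eta02 ot oA He.
pose aff (w : R[i]) := x + T%:C * w.
pose aff' (w : R[i]) := (w - x) / T%:C.
have cT : T%:C != 0 by rewrite eq_complex /= gt_eqF.
have affK w : aff (aff' w) = w by rewrite /aff /aff' mulrC divfK // addrC subrK.
have dist v w : normc (aff v - aff w) = T * normc (v - w).
  rewrite /aff opprD addrACA subrr add0r -mulrBr Normc.normcM normcE.
  by rewrite expr0n addr0 sqrtr_sqr gtr0_norm.
have sub1 : disc x T `<=` disc 0 1.
  by move=> w /sub; rewrite /disc /= => /lt_trans; apply.
have sF := subharmonic_affine T0 sub1 sf.
have aff_in w : normc w < 1 -> disc x T (aff w).
  move=> w1; rewrite /disc /= -[X in aff w - X](affK x) dist /aff' subrr mul0r subr0.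
  by rewrite gtr_pMr.
have aff'_in w : disc x t w -> normc (aff' w) < r.
  move=> wt; have := dist (aff' w) 0; rewrite affK /aff mulr0 addr0 subr0 => E.
  by rewrite -(ltr_pM2l T0) -E (_ : T * r = t) // /T divfK ?gt_eqF.
have FS w : normc w < 1 -> (f (aff w) <= (S + C)%:E)%E by move=> /aff_in/fS'.
pose q i := aff' (p i).
have qr i : normc (q i) < r by exact/aff'_in/ot.
have q1 i : normc (q i) < 1 := lt_trans (qr i) r1.
have distq i w : normc (aff w - p i) = T * normc (w - q i) by rewrite -{1}(affK (p i)) dist.
pose sg := (S + C - b') / L; have sg0 : 0 < sg by rewrite divr_gt0 //; lra.
have sgm i : 0 <= sg * m i by rewrite mulr_ge0 // ltW.
have eT : 0 < eta / T by rewrite divr_gt0.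
have etaE w i : (eta / T <= normc (w - q i)) = (eta <= normc (aff w - p i)).
  by rewrite distq ler_pdivrMr // mulrC.
have sumE w : \sum_i sg * m i * blaschke_ln (q i) w = sg * \sum_i m i * blaschke_ln (q i) w.
  by rewrite mulr_sumr; apply: eq_bigr => i _; rewrite mulrA.
have /= comp := @subharmonic_le_blaschke R _ n q (fun i => sg * m i) (eta / T)
  (S + C) sF FS q1 sgm eT.
have {}comp w : normc w < 1 -> (forall i, eta <= normc (aff w - p i)) ->
    (f (aff w) <= (S + C + sg * \sum_i m i * blaschke_ln (q i) w)%:E)%E.
  move=> w1 we; rewrite -sumE; apply: comp => // [v v1 ve [i vi]|i]; last by rewrite etaE.
  have vp : normc (aff v - p i) < eta0.
    by rewrite distq vi mulrC divfK ?gt_eqF //; lra.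
  apply: (le_trans (ltW (fnear _ _ (op i) vp))); rewrite lee_fin sumE.
  have {}ve j : eta <= normc (aff v - p j) by rewrite -etaE.
  (* The distance to the rescaled pole is r / t times the original one and the Blaschke denominator
     is at most 2, which the 4 in the logarithm absorbs. *)
  have blge j : m j * ln (4 * t / normc (aff v - p j)) + m j * ln r^-1 >=
      - (m j * blaschke_ln (q j) v).
    rewrite -mulrDr -mulrN ler_wpM2l // /blaschke_ln.
    have N0 : 0 < normc (aff v - p j) by exact: lt_le_trans (ve j).
    have Nq : normc (v - q j) = normc (aff v - p j) * r / t.
      by rewrite distq /T; field; rewrite !gt_eqF.
    have E1 : ln (normc (v - q j)) = ln (normc (aff v - p j)) + ln r - ln t.
      by rewrite Nq ln_div ?posrE ?mulr_gt0 // lnM ?posrE.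
    have E2 : ln (4 * t / normc (aff v - p j)) = ln 4 + ln t - ln (normc (aff v - p j)).
      by rewrite ln_div ?posrE ?mulr_gt0 // lnM ?posrE.
    have D0 := blaschke_den_gt0 (q1 j) v1.
    have : ln (normc (1 - (q j)^* * v)) <= ln 2.
      by rewrite ler_ln ?posrE // blaschke_den_le2.
    have : ln 2 <= ln (4 : R) by rewrite ler_ln ?posrE //; lra.
    by rewrite E1 E2 lnV ?posrE //; lra.
  have : - \sum_j m j * blaschke_ln (q j) v <= L.
    rewrite -sumrN; apply: (@le_trans _ _
      (\sum_j (m j * ln (4 * t / normc (aff v - p j)) + m j * ln r^-1))).
      by apply: ler_sum => j _.
    by rewrite big_split /= -mulr_suml msum mul1r lerD2r; exact: pot.
  move=> bl; have sgL : sg * L = S + C - b' by rewrite /sg divfK ?gt_eqF.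
  have := ler_wpM2l (ltW sg0) bl; rewrite mulrN sgL; lra.
have key w : disc x t w -> (f w <= (Num.max b' (S + C - sg * blaschke_gap r))%:E)%E.
  move=> wt; have [/existsP[i wi]|/existsPn nw] := boolP [exists i, normc (w - p i) < eta].
    apply: (@le_trans _ _ b'%:E); last by rewrite lee_fin le_max lexx.
    by apply/ltW/(fnear _ _ (op i)); lra.
  have {}nw i : eta <= normc (w - p i) by rewrite leNgt nw.
  have w'r := aff'_in _ wt.
  have := comp (aff' w) (lt_trans w'r r1); rewrite affK => /(_ nw)/le_trans; apply.
  rewrite lee_fin le_max; apply/orP; right; rewrite lerD2l -mulrN ler_wpM2l ?(ltW sg0) //.
  apply: (@le_trans _ _ (\sum_i m i * - blaschke_gap r)); last by rewrite -mulr_suml msum mul1r.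
  apply: ler_sum => i _; rewrite ler_wpM2l // blaschke_ln_le //.
  have := distq i (aff' w); rewrite affK => E.
  by rewrite -(pmulr_rgt0 _ T0) -E; exact: lt_le_trans (nw i).
have : S <= Num.max b' (S + C - sg * blaschke_gap r).
  by rewrite -lee_fin -SE; apply: ge_ereal_sup => _ [w wt <-]; exact: key.
rewrite le_max leNgt b'S /= => Sk.
have sgk : sg * blaschke_gap r <= C by lra.
have : S + C - b' <= C / blaschke_gap r * L.
  by rewrite -ler_pdivrMr // ler_pdivlMr.
lra.
Qed.

End Capacity.

Theorem theorem1p1 (R : realType) (r : R) (r_gt0 : 0 < r) (r_lt1 : r < 1) :
  exists c : R, 0 < c /\
  forall (d a eps : R), 0 < d -> 0 < a -> 0 < eps ->
  forall (x : R[i]) (t : R), 0 < t ->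
  disc x (t / r) `<=` disc 0 r ->
  forall omega : set R[i], omega `<=` disc x t ->
  class_A d a omega ->
  (eps%:E <= hausdorff_measure d omega)%E ->
  forall f : R[i] -> \bar R, subharmonic_on (disc 0 1) f ->
  forall M1 M2 : R,
  (ereal_sup (f @` disc 0%R 1%R) <= M1%:E)%E ->
  (M2%:E <= ereal_sup (f @` disc 0%R r))%E ->
  (ereal_sup (f @` disc x t) <=
     ereal_sup (f @` omega) +
     ((M1 - M2) * c *
        ln (4 * expR 1 * t * a `^ d^-1 / (r * (d * eps) `^ d^-1)))%:E)%E.
Proof.
have k0 := blaschke_gap_gt0 r_gt0 r_lt1; have [_ c1] := doubling_const_ge1 r_gt0 r_lt1.
pose c0 := doubling_const r / blaschke_gap r.
have c00 : 0 < c0 by rewrite divr_gt0 // (lt_le_trans ltr01).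
exists (40 * c0); split; first by rewrite mulr_gt0.
move=> d a eps d0 a0 e0 x t t0 sub omega ot oA He f sf M1 M2 HM1 HM2.
have fM z : normc z < 1 -> (f z <= M1%:E)%E.
  move=> z1; apply: le_trans HM1; apply: ereal_sup_ubound; exists z => //.
  by rewrite /disc /= subr0.
set L := ln _; pose Y := ln (a * t `^ d / eps).
have tp : 0 < t `^ d by apply: powR_gt0.
have Yge : - ln 3 - d * ln 2 <= Y.
  have [s /andP[s0 s2t] os] := class_A_diam d0 e0 ot He.
  have : eps <= 3 * (2 `^ d * (a * t `^ d)).
    rewrite -lee_fin; apply: (le_trans He).
    apply: (le_trans (class_A_measure_le d0 a0 oA s0 os)); rewrite lee_fin.
    rewrite -mulrA ler_wpM2l // mulrCA -powRM ?(ltW t0) // ler_wpM2l ?(ltW a0) //.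
    by rewrite ge0_ler_powR ?nnegrE ?(ltW d0) ?(ltW s0) ?mulr_ge0 ?(ltW t0).
  rewrite -ler_ln ?posrE ?mulr_gt0 ?powR_gt0 //.
  rewrite !lnM ?posrE ?mulr_gt0 ?powR_gt0 //.
  by rewrite /Y !lnM ?posrE ?mulr_gt0 ?invr_gt0 // lnV ?posrE // !ln_powR; lra.
have LE : L = ln 4 + 1 + ln r^-1 + (Y - ln d) / d.
  have ap : 0 < a `^ d^-1 by apply: powR_gt0.
  have dp : 0 < (d * eps) `^ d^-1 by apply: powR_gt0; rewrite mulr_gt0.
  have e1 : 0 < expR 1 :> R by apply: expR_gt0.
  rewrite /L /Y ln_div ?posrE ?mulr_gt0 // !lnM ?posrE ?mulr_gt0 ?invr_gt0 //.
  rewrite !lnV ?posrE // !ln_powR lnM ?posrE // expRK.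
  by field; rewrite gt_eqF.
have lr0 : 0 <= ln r^-1 by rewrite ln_ge0 // invf_ge1 // ltW.
have /andP[L'0 L'L] := log_constant_bound d0 lr0 Yge.
rewrite -LE in L'L.
have main (b : R) : (forall p, omega p -> (f p <= b%:E)%E) ->
    (ereal_sup (f @` disc x t) <= (b + (M1 - M2) * (40 * c0) * L)%:E)%E.
  move=> fb; apply: ge_ereal_sup => _ [z xz <-].
  apply/lee_addgt0Pr => dl dl0; rewrite -EFinD.
  pose C := 40 * c0 * L.
  have L0 : 0 < L by have := lt_le_trans L'0 L'L; rewrite pmulr_rgt0.
  have C0 : 0 < C := mulr_gt0 (mulr_gt0 (ltr0Sn R 39) c00) L0.
  (* The supremum over the disc of radius [r] need not be attained; lowering [M2] by [dl / C] yields
     a point [z0] and costs exactly [dl] in the conclusion. *)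
  pose M2' := M2 - dl / C.
  have : (M2'%:E < ereal_sup (f @` disc 0%R r))%E.
    by apply: lt_le_trans HM2; rewrite lte_fin gtrBl divr_gt0.
  case/ereal_sup_gt => _ [z0 z0r <-] /ltW Mz0.
  have {}z0r : normc z0 < r by move: z0r; rewrite /disc /= subr0.
  have M21 : M2' <= M1 by rewrite -lee_fin (le_trans Mz0) // fM // (lt_trans z0r).
  apply: (le_trans (subharmonic_remez r_gt0 r_lt1 d0 a0 e0 t0 L'0 sub ot oA He
    sf fM z0r Mz0 fb xz)).
  rewrite lee_fin -[leRHS]addrA lerD2l.
  have -> : (M1 - M2) * (40 * c0) * L + dl = (M1 - M2') * C.
    by rewrite /M2' /C; field; rewrite !gt_eqF //; lra.
  rewrite -[_ * doubling_const r / _]mulrA -/c0 -mulrA ler_wpM2l ?subr_ge0 //.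
  have -> : C = c0 * (40 * L) by rewrite /C; ring.
  by rewrite ler_wpM2l ?(ltW c00).
have fo p : omega p -> (f p <= ereal_sup (f @` omega))%E.
  by move=> op; apply: ereal_sup_ubound; exists p.
move: fo; case: (ereal_sup (f @` omega)) => [b| |] fo.
- by rewrite -EFinD; exact: main.
- by rewrite addye // leey.
(* If [f] is -oo on [omega], the finite estimate holds for every [b], so [f] is -oo on the whole
   disc. *)
- rewrite addNye leeNy_eq; apply/eqP/eq_ninfty => b.
  set C := (M1 - M2) * (40 * c0) * L in main *.
  have -> : b%:E = ((b - C) + C)%:E by rewrite subrK.
  by apply: main => p /fo; rewrite leeNy_eq => /eqP ->; rewrite leNye.
Qed.
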